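(* Consider a binary cellular automaton on $\mathbb Z$ and let $\eta\in\{0,1\}^{\mathbb Z}$ be a doubly periodic configuration for it, with spatial period $\sigma$, temporal period $\pi$, shift period $\pi_0$ and shift $\sigma_0$. Let the initial state be $\xi_0=\eta$ and assume that $\eta$ is irreducible. Let $T$, $W_y$, $T'$ be the matrices associated with the expansion graph $\mathcal E$ with edges $e_1,\dots,e_{d_T}$ and displacement labels $D(e_k)$ (see context). Then the Lyapunov profile $L$ is proper, independent of the initial defect configuration $\Delta_0$ (nonzero, finitely supported), and is given as follows. Let $$\Lambda(y)=\log \operatorname{spr}(T\cdot W_y),\qquad y\in\mathbb R,$$ where $\operatorname{spr}$ denotes the spectral radius. Then $L$ is given by the Legendre transform of $\Lambda$, that is, by $$L(\alpha)=\inf_{y\in\mathbb R}\bigl(-y\alpha+\Lambda(y)\bigr).$$ Furthermore, let $\lambda_1=\operatorname{spr}(T)$ be the largest eigenvalue of $T$. Then the maximal Lyapunov exponent (MLE) $\lambda=\max_\alpha L(\alpha)$ is given by $$\lambda=\log\operatorname{spr}(T')=\log\lambda_1 .$$ For $k=1,\dots,d_T$ define constants $c_k$ so that the $k$th diagonal element $T^n_{kk}$ of $T^n$ satisfies $$T^n_{kk}\sim c_k\lambda_1^n\qquad\text{as } n\to\infty.$$ Then the unique MLE direction (the unique $\alpha$ at which the maximum of $L$ is achieved) equals $$\sum_{k=1}^{d_T}c_k D(e_k).$$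
   Context: A binary cellular automaton (CA) on $\mathbb Z$ is given by a finite ordered neighborhood $\mathcal N\subset\mathbb Z$ and $\phi:\{0,1\}^{|\mathcal N|}\to\{0,1\}$; its global map is $\Phi(\xi)(x)=\phi(\xi|_{x+\mathcal N})$, and the trajectory is $\xi_{t+1}=\Phi(\xi_t)$. Defect accumulation dynamics: for a configuration $\zeta$ let $\zeta^{(y)}$ be $\zeta$ with the state at $y$ flipped. Put $\mathrm{change}_t(y,x)=1$ if $\Phi(\xi_t^{(y)})(x)\neq\xi_{t+1}(x)$ and $0$ otherwise. Given $\Delta_0:\mathbb Z\to\mathbb Z_{\ge0}$, nonzero with finite support, define $\Delta_{t+1}(x)=\sum_{y\in x+\mathcal N}\mathrm{change}_t(y,x)\Delta_t(y)$; write $\Delta(x,t)=\Delta_t(x)$ and $\delta_t(x)=1$ if $\Delta_t(x)>0$, $0$ otherwise. Lyapunov profile: $L(\alpha)=\lim_{\epsilon\downarrow0}\limsup_{t\to\infty}\frac1t\log\bigl(\sum_{x:|x/t-\alpha|<\epsilon}\Delta(x,t)\bigr)\in\{-\infty\}\cup[0,\infty)$, with $\log 0=-\infty$. $L$ is proper if replacing $\limsup$ by $\liminf$ gives the same value for every $\alpha$. Doubly periodic configuration: there are $\pi\ge1$ with $\Phi^\pi(\eta)=\eta$ and $\sigma\ge1$ with $\eta(x)=\eta(x\bmod\sigma)$ for all $x$; $\pi$ and $\sigma$ are taken smallest possible. The shift period $\pi_0\ge1$ is the smallest time for which there is $\sigma_0\in\{0,\dots,\sigma-1\}$ with $(\Phi^{\pi_0}\eta)(x)=\eta(x-\sigma_0)$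 for all $x$; this $\sigma_0$ is the shift. Irreducibility: the reduced kernel $K:\mathbb Z_\sigma\times\mathbb Z_\sigma\to\{0,1\}$ has $K(a,b)=1$ exactly when, with $\xi_0=\eta$ and one initial defect at $a$, $\delta_\pi(x)=1$ for some $x\equiv b\pmod\sigma$. $\eta$ is irreducible if $K$ is irreducible. Expansion graph $\mathcal E$: a directed multigraph with vertex set $\mathbb Z_\sigma=\{0,\dots,\sigma-1\}$. For each $i$, start with $\xi_0=\eta$ and $\Delta_0=\mathbf 1_{\{i\}}$; if $\Delta_{\pi_0}$ has $n_i\ge 0$ nonzero values $N^{(i)}_j$, at the sites $i+D^{(i)}_j$, $j=1,\dots,n_i$, then for each $j$ there is an edge from $i$ to $(i+D_j^{(i)}-\sigma_0)\bmod\sigma$ with displacement label $D(e)=D^{(i)}_j$ and size label $N(e)=N^{(i)}_j$. Let $e_1,\dots,e_{d_T}$ be an ordering of all edges, $d_T=\sum_i n_i$. Matrices: $T$ is the $d_T\times d_T$ matrix with $T_{k\ell}=N(e_k)$ if the terminal vertex of $e_k$ equals the initial vertex of $e_\ell$, and $T_{k\ell}=0$ otherwise. $W_y=\operatorname{diag}(\exp(yD(e_k)),\,k=1,\dots,d_T)$. $T'$ is the $\sigma\times\sigma$ matrix with $T'_{i_1,i_2}=\sum N(e)$, summed over edges $e$ from $i_1$ to $i_2$.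
   Formalization: Λ, λ and the MLE direction carry a factor 1/π_0 (without it the claim fails for π_0>1, e.g. rule 1+a+b+c mod 2 at η=0); existence of the c_k is asserted only for primitive T, since for periodic T no such constants exist; the direction formula holds for any such c_k. *)

(* Defs.v *)
From HB Require Import structures.
From mathcomp Require Import all_boot all_order all_algebra.
From mathcomp Require Import complex.
From mathcomp Require Import all_classical all_reals all_analysis.

Set Implicit Arguments.
Unset Strict Implicit.
Unset Printing Implicit Defensive.

Import Order.TTheory GRing.Theory Num.Theory numFieldNormedType.Exports.

Local Open Scope classical_set_scope.
Local Open Scope ring_scope.

Definition config := int -> bool.

Record cellular_automaton := CellularAutomaton {
  nbhd : seq int;
  nbhd_uniq : uniq nbhd;
  local_rule : (size nbhd).-tuple bool -> bool
}.

Definition global_map (ca : cellular_automaton) (xi : config) : config :=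
  fun x => local_rule (map_tuple (fun v => xi (x + v)) (in_tuple (nbhd ca))).

Definition flip (zeta : config) (y : int) : config :=
  fun x => if x == y then ~~ zeta x else zeta x.

Definition change (ca : cellular_automaton) (xi : config) (y x : int) : bool :=
  global_map ca (flip xi y) x != global_map ca xi x.

Definition trajectory (ca : cellular_automaton) (xi0 : config) (t : nat) :
  config := iter t (global_map ca) xi0.

(* [defects ca xi0 D0 t x] is Delta(x, t) for the trajectory started at [xi0];
   as [nbhd ca] is duplicate-free, the sum ranges over the set x + N. *)
Fixpoint defects (ca : cellular_automaton) (xi0 : config) (D0 : int -> nat)
    (t : nat) : int -> nat :=
  if t is s.+1 then
    fun x => (\sum_(v <- nbhd ca)
      change ca (trajectory ca xi0 s) (x + v)%R x * defects ca xi0 D0 s (x + v)%R)%N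
  else D0.

Definition initial_defects (D0 : int -> nat) : Prop :=
  (exists x, D0 x != 0%N) /\ finite_set [set x | D0 x != 0%N].

Definition point_defect (a : int) : int -> nat := fun x => (x == a : nat).

Section LyapunovProfile.
Variables (R : realType) (ca : cellular_automaton) (xi0 : config).
Variable D0 : int -> nat.

(* For t >= 1 the window {x : |x/t - alpha| < eps} is finite, so that the
   finitely supported sum [\sum_(x \in _)] is the actual sum over the window. *)
Definition window_defects (alpha eps : R) (t : nat) : R :=
  \sum_(x \in [set x : int | `|x%:~R / t%:R - alpha| < eps])
    ((defects ca xi0 D0 t x)%:R : R).

(* [lne] is the extended logarithm, with [lne 0 = -oo]. *)
Definition window_growth (alpha eps : R) (t : nat) : \bar R :=
  ((t%:R^-1)%:E * lne (window_defects alpha eps t)%:E)%E.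

Definition lyapunov_profile (alpha : R) : \bar R :=
  lim (limn_esup (window_growth alpha eps) @[eps --> 0^'+]).

Definition lower_lyapunov_profile (alpha : R) : \bar R :=
  lim (limn_einf (window_growth alpha eps) @[eps --> 0^'+]).

Definition proper_profile : Prop :=
  forall alpha, lower_lyapunov_profile alpha = lyapunov_profile alpha.

End LyapunovProfile.

Definition least_positive (P : nat -> Prop) (n : nat) : Prop :=
  [/\ (0 < n)%N, P n & forall m, (0 < m)%N -> P m -> (n <= m)%N].

Definition spatially_periodic (eta : config) (s : nat) : Prop :=
  forall x : int, eta x = eta (x %% s%:Z)%Z.

Definition temporally_periodic (ca : cellular_automaton) (eta : config)
    (p : nat) : Prop :=
  trajectory ca eta p =1 eta.

Definition shifted_by (ca : cellular_automaton) (eta : config) (p s : nat) :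
    Prop :=
  forall x : int, trajectory ca eta p x = eta (x - s%:Z).

(* Spatial period [sigma], temporal period [p], shift period [p0] and shift
   [s0]. *)
Record doubly_periodic (ca : cellular_automaton) (eta : config)
    (sigma p p0 s0 : nat) : Prop := DoublyPeriodic {
  spatial_period : least_positive (spatially_periodic eta) sigma;
  temporal_period : least_positive (temporally_periodic ca eta) p;
  shift_period : least_positive
    (fun q => exists2 s : nat, (s < sigma)%N & shifted_by ca eta q s) p0;
  shift_lt : (s0 < sigma)%N;
  shift_eq : shifted_by ca eta p0 s0
}.

(* The exponent is required to be positive, so that the 1 x 1 zero matrix is
   not irreducible. *)
Definition irreducible_mx (F : numDomainType) (n : nat) (A : 'M[F]_n) : Prop :=
  forall i j, exists2 m : nat, (0 < m)%N & 0 < (A ^+ m) i j.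

Definition primitive_mx (F : numDomainType) (n : nat) (A : 'M[F]_n) : Prop :=
  exists2 m : nat, (0 < m)%N & forall i j, 0 < (A ^+ m) i j.

Definition reduced_kernel (ca : cellular_automaton) (eta : config)
    (sigma p : nat) : 'M[int]_sigma :=
  \matrix_(a, b)
    (`[< exists2 x : int, (x = b%:Z %[mod sigma%:Z])%Z &
         (0 < defects ca eta (point_defect a%:Z) p x)%N >] : nat)%:Z.

Definition irreducible_config (ca : cellular_automaton) (eta : config)
    (sigma p : nat) : Prop :=
  irreducible_mx (reduced_kernel ca eta sigma p).

(* An edge of the expansion graph is determined by its initial vertex and its
   displacement label. *)
Definition edge (sigma : nat) : Type := ('I_sigma * int)%type.

Section ExpansionGraph.
Variables (ca : cellular_automaton) (eta : config) (sigma p0 s0 : nat).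

Definition initial_vertex (e : edge sigma) : 'I_sigma := e.1.

Definition displacement (e : edge sigma) : int := e.2.

(* The terminal vertex, as an integer in {0, ..., sigma - 1}. *)
Definition terminal_vertex (e : edge sigma) : int :=
  ((e.1%:Z + e.2 - s0%:Z) %% sigma%:Z)%Z.

Definition edge_size (e : edge sigma) : nat :=
  defects ca eta (point_defect e.1%:Z) p0 (e.1%:Z + e.2).

Definition edge_ordering (d : nat) (e : d.-tuple (edge sigma)) : Prop :=
  uniq e /\ forall f : edge sigma, (f \in e) = (0 < edge_size f)%N.

Variables (R : realType) (d : nat) (e : d.-tuple (edge sigma)).

Definition edge_mx : 'M[R]_d :=
  \matrix_(k, l)
    if terminal_vertex (tnth e k) == (initial_vertex (tnth e l))%:Z
    then (edge_size (tnth e k))%:R else 0.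

Definition weight_mx (y : R) : 'M[R]_d :=
  diag_mx (\row_k expR (y * (displacement (tnth e k))%:~R)).

Definition vertex_mx : 'M[R]_sigma :=
  \matrix_(i, j) \sum_(k < d | (initial_vertex (tnth e k) == i) &&
                               (terminal_vertex (tnth e k) == j%:Z))
    (edge_size (tnth e k))%:R.

End ExpansionGraph.

(* The set is finite, and nonempty for n >= 1, so that the supremum is the
   largest modulus of a complex eigenvalue. *)
Definition spr (R : realType) (n : nat) (A : 'M[R]_n) : R :=
  sup [set ComplexField.Normc.normc z | z in
    [set z : R[i] | eigenvalue (map_mx (fun x : R => x%:C)%C A) z]].

Definition legendre (R : realType) (Lam : R -> R) (alpha : R) : \bar R :=
  ereal_inf [set (- y * alpha + Lam y)%:E | y in [set: R]].

Definition is_maximum (R : realType) (L : R -> \bar R) (lam : \bar R) : Prop :=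
  (exists alpha, L alpha = lam) /\ forall alpha, (L alpha <= lam)%E.

Definition maximizer (R : realType) (L : R -> \bar R) (alpha : R) : Prop :=
  forall beta, (L beta <= L alpha)%E.

Definition diag_constants (R : realType) (d : nat) (A : 'M[R]_d)
    (c : 'I_d -> R) : Prop :=
  forall k, (fun n : nat => (A ^+ n) k k : R^o) ~_\oo
            (fun n : nat => c k * spr A ^+ n : R^o).

(* Main.v *)
(** Along one shift period the defects move on the expansion graph.  If [v] is the
    Perron eigenvector of the vertex matrix weighted by [exp (y D)], with eigenvalue
    [rho], then [sum_x Delta(x, n p0) e^(y x) v_(x - n s0)] is multiplied by exactly
    [rho] at each period.  So for every [y] the sum [sum_x Delta(x, t) e^(y x)] lies
    between two constant multiples of [e^(t Lambda y)], for every initial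
    configuration of defects.

    Chernoff's inequality then bounds the window growth from above by
    [Lambda y - y alpha].  For the lower bound, the simplicity of the Perron
    eigenvalue makes [Lambda] differentiable, so that tilting at a point where
    [Lambda' y] is near [alpha] concentrates the mass near [alpha t]; such a point,
    with [Lambda y - y Lambda' y >= inf (Lambda y - y alpha)], is found by minimising
    [Lambda y - y alpha] plus a small multiple of [y^2].

    Perturbing the eigenvalue at [y = 0] gives
    [p0 Lambda' 0 = sum_k u_k v_k D(e_k)], where [u], [v] are the normalised left and
    right Perron eigenvectors of [T].  Cesaro means of [T^n / lambda1^n] converge to
    [v u], which identifies [c_k] with [v_k u_k]. *)

Require Import Defs.
From HB Require Import structures.
From mathcomp Require Import all_boot all_order all_algebra.
From mathcomp Require Import complex ring lra zify.
From mathcomp Require Import all_classical all_reals all_analysis.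

Import Order.TTheory GRing.Theory Num.Theory numFieldNormedType.Exports.

Set Implicit Arguments.
Unset Strict Implicit.
Unset Printing Implicit Defensive.

Local Open Scope classical_set_scope.
Local Open Scope ring_scope.

(** * Perron-Frobenius theory *)

(** An irreducible [T] may be periodic: then no power of it is positive and its normalised powers
    oscillate. This is why sums of powers, rather than single powers, supply positivity, and why the
    constants are reached through averages. Irreducibility is given at time [p] whereas the graph
    runs at time [p0], so the two periods have to be compared before the hypothesis says anything
    about the graph. The infimum in the Legendre transform may be unattained, and then a tilt of
    slope exactly [alpha] need not exist. A slope within [eps] of [alpha] is enough, because the
    window width is sent to 0 only after [t] has tended to infinity. The maximum of [L] is located
    by a tangent inequality for [Lambda] at 0, which comes from comparing the upper and lower bounds
    for the mass of one window. *)

Lemma exprmx_ge0 (F : numDomainType) n (A : 'M[F]_n) :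
  (forall i j, 0 <= A i j) -> forall m i j, 0 <= (A ^+ m) i j.
Proof.
move=> A0; elim=> [|m IH] i j; first by rewrite expr0 mxE ler0n.
by rewrite exprS -mulmxE mxE sumr_ge0// => k _; rewrite mulr_ge0.
Qed.

Lemma exprmx_tr (F : comPzRingType) n (A : 'M[F]_n) m : (A^T) ^+ m = (A ^+ m)^T.
Proof.
elim: m => [|m IH]; first by rewrite !expr0 trmx1.
by rewrite exprS exprSr -!mulmxE trmx_mul IH.
Qed.

Lemma irreducible_tr (F : numDomainType) n (A : 'M[F]_n) :
  irreducible_mx A -> irreducible_mx A^T.
Proof.
by move=> irrA i j; have [m m0 Am] := irrA j i; exists m; rewrite // exprmx_tr mxE.
Qed.

(** A positive polynomial in [A]: it commutes with [A], so it can be applied to eigenvector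
    equations and inequalities, and it makes nonzero nonnegative vectors positive. *)
Lemma irreducible_power_sum (R : realType) n (A : 'M[R]_n) :
  (forall i j, 0 <= A i j) -> irreducible_mx A ->
  exists N, forall i j, 0 < (\sum_(m < N) A ^+ m) i j.
Proof.
move=> A0 irrA.
have /choice[f fP] : forall ij : 'I_n * 'I_n, exists m, 0 < (A ^+ m) ij.1 ij.2.
  by case=> i j; have [m _ ?] := irrA i j; exists m.
exists (\max_ij f ij).+1 => i j; rewrite summxE.
have lt : (f (i, j) < (\max_ij f ij).+1)%N by rewrite ltnS (leq_bigmax (i, j)).
rewrite (bigD1 (Ordinal lt))//= ltr_pwDl ?(fP (i, j))// sumr_ge0// => k _.
exact: exprmx_ge0.
Qed.

Lemma comm_power_sum (R : pzRingType) n (A : 'M[R]_n) N :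
  (\sum_(m < N) A ^+ m) *m A = A *m \sum_(m < N) A ^+ m.
Proof.
by rewrite !mulmxE mulr_suml mulr_sumr; apply: eq_bigr => m _; rewrite -exprS -exprSr.
Qed.

Lemma mulmx_pos (R : realType) m n (x : 'rV[R]_m) (P : 'M[R]_(m, n)) :
  (forall i, 0 <= x 0 i) -> x != 0 -> (forall i j, 0 < P i j) ->
  forall j, 0 < (x *m P) 0 j.
Proof.
move=> x0 xn0 P0 j.
have [i xi] : exists i, x 0 i != 0.
  apply/existsP; apply: contraNT xn0; rewrite negb_exists => /forallP h.
  by apply/eqP/rowP => i; rewrite mxE; have := h i; rewrite negbK => /eqP.
rewrite mxE (bigD1 i)//= ltr_pwDl//.
  by rewrite mulr_gt0// lt_def xi x0.
by apply: sumr_ge0 => k _; rewrite mulr_ge0// ltW.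
Qed.

(** * Continuity and closedness for the compactness argument *)

Lemma continuous_sum (R : realType) (T : topologicalType) (I : Type) (r : seq I)
    (F : I -> T -> R) :
  (forall i, continuous (F i)) -> continuous (fun x => \sum_(i <- r) F i x).
Proof.
move=> cF x; apply: cvg_big => [|i _]; last exact: cF.
exact: add_continuous.
Qed.

Lemma cvgr_sum (R : realType) (T : Type) (F : set_system T) (FF : Filter F)
    (I : Type) (r : seq I) (f : I -> T -> R) (l : I -> R) :
  (forall i, f i x @[x --> F] --> l i) ->
  \sum_(i <- r) f i x @[x --> F] --> \sum_(i <- r) l i.
Proof.
by move=> fl; apply: cvg_big => [|i _]; [exact: add_continuous|exact: fl].
Qed.

Lemma closed_leT (R : realType) (T : topologicalType) (f g : T -> R) :
  continuous f -> continuous g -> closed [set x | f x <= g x].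
Proof.
move=> cf cg.
rewrite (_ : [set x | _] = (fun x => g x - f x) @^-1` [set y | 0 <= y]); last first.
  by apply/seteqP; split=> x /=; rewrite subr_ge0.
apply: preimage_closed; last exact: closed_ge.
by move=> x _; apply: cvgB; [exact: cg|exact: cf].
Qed.

Lemma closed_forall (T : topologicalType) (I : Type) (P : I -> T -> Prop) :
  (forall i, closed [set x | P i x]) -> closed [set x | forall i, P i x].
Proof.
move=> cP; rewrite (_ : [set x | _] = \bigcap_(i in setT) [set x | P i x]).
  by apply: closed_bigI => i _.
by apply/seteqP; split=> [x h i _|x h i]; exact: h.
Qed.

(* The largest [r] such that [r x <= x A] for some [x] in the simplex is attained;
   if [x A != r x], multiplying by the positive matrix [P] makes every inequality
   strict and [r] could be increased. *)
Lemma perron_left (R : realType) n (A : 'M[R]_n) :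
  (0 < n)%N -> (forall i j, 0 <= A i j) -> irreducible_mx A ->
  exists2 rho : R, 0 < rho &
    exists2 u : 'rV[R]_n, (forall i, 0 < u 0 i) & u *m A = rho *: u.
Proof.
move=> n0 A0 irrA.
have [N P0] := irreducible_power_sum A0 irrA.
set P := \sum_(m < N) A ^+ m in P0.
have PA : P *m A = A *m P by exact: comm_power_sum.
(* Summing [r x_i <= (x A)_i] over [i] gives [r <= C] on the simplex. So [r] can be a coordinate of
   the compact set [S], and the maximum is that of the first projection. *)
pose C := \sum_i \sum_j A i j.
pose S : set (R * 'rV[R]_n) :=
  (`[0, C] `*` [set x : 'rV[R]_n | forall i, `[0, 1]%classic (x ord0 i)])
  `&` ([set q : R * 'rV[R]_n | \sum_i q.2 0 i <= 1] `&` [set q : R * 'rV[R]_n | 1 <= \sum_i q.2 0 i]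
  `&` [set q : R * 'rV[R]_n | forall i, q.1 * q.2 0 i <= (q.2 *m A) 0 i]).
have c2 i : continuous (fun q : R * 'rV[R]_n => q.2 0 i).
  by move=> q; apply: (@continuous_comp _ _ _ snd (fun x : 'rV[R]_n => x 0 i));
    [exact: cvg_snd|exact: coord_continuous].
have c1 : continuous (fun q : R * 'rV[R]_n => q.1) by move=> q; exact: cvg_fst.
have cS : compact S.
  apply: compact_closedI.
    apply: compact_setX; first exact: segment_compact.
    by apply: (@rV_compact R n (fun=> `[0, 1]%classic)) => _; exact: segment_compact.
  apply: closedI; first apply: closedI.
  - apply: closed_leT; last by move=> q; exact: cvg_cst.
    exact: (continuous_sum c2).
  - apply: closed_leT; first by move=> q; exact: cvg_cst.
    exact: (continuous_sum c2).
  apply: closed_forall => i; apply: closed_leT.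
    by move=> q; apply: cvgM; [exact: c1|exact: c2].
  under eq_fun do rewrite mxE.
  apply: (@continuous_sum _ _ _ _ (fun j (q : R * 'rV[R]_n) => q.2 0 j * A j i)) => j q.
  by apply: cvgM; [exact: c2|exact: cvg_cst].
have inS r (x : 'rV[R]_n) : 0 <= r -> (forall i, 0 <= x 0 i) -> \sum_i x 0 i = 1 ->
    (forall i, r * x 0 i <= (x *m A) 0 i) -> S (r, x).
  move=> r0 x0 x1 xA.
  have xle i : x 0 i <= 1.
    by rewrite -x1 (bigD1 i)//= lerDl sumr_ge0.
  split=> /=; last by rewrite x1 lexx.
  split=> [|i]; rewrite /= in_itv/= ?x0 ?xle// r0/=.
  have -> : r = \sum_i r * x 0 i by rewrite -mulr_sumr x1 mulr1.
  have -> : C = \sum_j \sum_i A i j by rewrite exchange_big.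
  apply: ler_sum => j _; apply: (le_trans (xA j)); rewrite mxE.
  by apply: ler_sum => i _; rewrite -[leRHS]mul1r ler_wpM2r.
have normS r (x : 'rV[R]_n) : 0 <= r -> (forall i, 0 < x 0 i) ->
    (forall i, r * x 0 i <= (x *m A) 0 i) -> exists y, S (r, y).
  move=> r0 x0 xA.
  have s0 : 0 < \sum_i x 0 i.
    by rewrite (bigD1 (Ordinal n0))//= ltr_pwDl// sumr_ge0// => i _; exact: ltW.
  exists ((\sum_i x 0 i)^-1 *: x); apply: inS => //.
  - by move=> i; rewrite mxE mulr_ge0// ?invr_ge0; exact: ltW.
  - under eq_bigr do rewrite mxE.
    by rewrite -mulr_sumr mulVf// gt_eqF.
  - move=> i; rewrite -scalemxAl !mxE mulrCA ler_pM2l ?invr_gt0//.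
    by move: (xA i); rewrite [leRHS]mxE.
have S0 : S !=set0.
  have [|||y Sy] := @normS 0 (const_mx 1) => //; last by exists (0, y).
    by move=> i; rewrite mxE.
  by move=> i; rewrite mul0r mxE sumr_ge0// => j _; rewrite mulr_ge0 ?mxE.
have [|[rho x] /set_mem Sx max] := @compact_EVT_max _ R fst S S0 cS.
  by apply: continuous_subspaceT => q; exact: cvg_fst.
case: Sx => -[/=]; rewrite in_itv/= => /andP[rho0 _] xI [[x1 x2] xA].
have x0 i : 0 <= x 0 i by have := xI i; rewrite in_itv/= => /andP[].
have xn0 : x != 0.
  apply: contraTneq x2 => ->; rewrite -ltNge; under eq_bigr do rewrite mxE.
  by rewrite big1// ltr01.
set z := x *m P; have z0 i : 0 < z 0 i by exact: mulmx_pos.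
have eqx : x *m A = rho *: x.
  apply/eqP/negPn/negP => neq.
  have w0 i : 0 < ((x *m A - rho *: x) *m P) 0 i.
    apply: mulmx_pos => [{}i||//]; first by rewrite mxE [X in _ + X]mxE [X in _ - X]mxE subr_ge0.
    by rewrite subr_eq0.
  have zA i : rho * z 0 i < (z *m A) 0 i.
    rewrite -subr_gt0; have := w0 i.
    by rewrite mulmxBl -mulmxA -PA mulmxA -scalemxAl !mxE.
  (* The least relative slack in the strict inequalities for [z], capped by 1: [rho] can be
     increased by this amount. *)
  pose e := \big[Num.min/1]_i ((z *m A) 0 i / z 0 i - rho).
  have e0 : 0 < e.
    by apply: lt_bigmin => // i _; rewrite subr_gt0 ltr_pdivlMr.
  have [|||y Sy] := @normS (rho + e) z => //; first by rewrite addr_ge0// ltW.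
    move=> i; rewrite -ler_pdivlMr// -lerBrDl.
    exact: bigmin_le.
  have /= := max (rho + e, y) (mem_set Sy).
  by rewrite gerDl leNgt e0.
have zA : z *m A = rho *: z by rewrite /z -mulmxA PA mulmxA eqx scalemxAl.
exists rho; last by exists z.
(* If [rho] were 0, then [z *m A ^+ m] would vanish, although [z] is positive and [A ^+ m] has a
   positive diagonal entry. *)
have [m m0 Am] := irrA (Ordinal n0) (Ordinal n0).
rewrite lt_def rho0 andbT; apply: contraTneq Am => r0.
have zAm : z *m A ^+ m = 0.
  case: m m0 => // m _; rewrite exprS -mulmxE mulmxA zA r0 scale0r mul0mx//.
rewrite -leNgt; have := congr1 (fun M : 'rV[R]_n => M 0 (Ordinal n0)) zAm.
rewrite !mxE (bigD1 (Ordinal n0))//= => zAm'.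
rewrite -(pmulr_rle0 _ (z0 (Ordinal n0))) -zAm' lerDl sumr_ge0// => i _.
by rewrite mulr_ge0 ?exprmx_ge0// ltW.
Qed.

Lemma expmx_eigen (F : fieldType) n (A : 'M[F]_n) rho (v : 'cV[F]_n) m :
  A *m v = rho *: v -> A ^+ m *m v = rho ^+ m *: v.
Proof.
move=> Av; elim: m => [|m IH]; first by rewrite !expr0 mul1mx scale1r.
by rewrite exprSr -mulmxE -mulmxA Av -scalemxAr IH scalerA -exprS.
Qed.

Lemma sum_expmx_eigen (F : fieldType) n (A : 'M[F]_n) rho (v : 'cV[F]_n) N :
  A *m v = rho *: v ->
  (\sum_(m < N) A ^+ m) *m v = (\sum_(m < N) rho ^+ m) *: v.
Proof.
move=> Av; rewrite mulmx_suml scaler_suml; apply: eq_bigr => m _.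
exact: expmx_eigen.
Qed.

(** Subtract from [x] the largest multiple of [v] that leaves a nonnegative vector [z]. It vanishes
    at some [i0], and row [i0] of a positive polynomial in [A], applied to the eigenvector [z],
    forces [z = 0]. *)
Lemma perron_simple (R : realType) n (A : 'M[R]_n) rho (v x : 'cV[R]_n) :
  (forall i j, 0 <= A i j) -> irreducible_mx A ->
  (forall i, 0 < v i 0) -> A *m v = rho *: v -> A *m x = rho *: x ->
  exists c, x = c *: v.
Proof.
move=> A0 irrA v0 Av Ax.
case: n A v x A0 irrA v0 Av Ax => [|n] A v x A0 irrA v0 Av Ax.
  by exists 0; apply/colP => -[].
have [N P0] := irreducible_power_sum A0 irrA.
have [i0 _ imin] := @Order.TotalTheory.arg_minP _ _ _ ord0 xpredT (fun i => x i 0 / v i 0) isT.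
pose c := x i0 0 / v i0 0; exists c.
pose z := x - c *: v.
have z0 i : 0 <= z i 0.
  by rewrite !mxE subr_ge0 -ler_pdivlMr// imin.
have zi0 : z i0 0 = 0 by rewrite !mxE /c mulfVK ?subrr// gt_eqF.
have Az : A *m z = rho *: z.
  by rewrite mulmxBr Ax -scalemxAr Av scalerBr !scalerA [c * _]mulrC.
have := sum_expmx_eigen N Az.
move=> /(congr1 (fun M : 'cV[R]_n.+1 => M i0 0)); rewrite [in RHS]mxE zi0 mulr0 mxE => /eqP.
rewrite psumr_eq0 => [/allP h|i _]; last by rewrite mulr_ge0 ?z0// ltW.
apply/eqP; rewrite -subr_eq0; apply/eqP/colP => i; rewrite [RHS]mxE.
have /implyP/(_ isT) := h i (mem_index_enum i).
by rewrite mulf_eq0 gt_eqF//= => /eqP.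
Qed.

Lemma eigenvalue_col (F : fieldType) n (A : 'M[F]_n) rho (v : 'cV[F]_n) :
  v != 0 -> A *m v = rho *: v -> eigenvalue A rho.
Proof.
move=> v0 Av; rewrite /eigenvalue /eigenspace kermx_eq0 row_free_unit.
apply: contra v0 => /mulKmx/(_ v) <-.
by rewrite mulmxBl Av mul_scalar_mx subrr mulmx0.
Qed.

(** For a complex left eigenvector [w] with eigenvalue [z], the triangle inequality gives
    [|z| |w| <= |w| A] entrywise; pairing with the positive right eigenvector [v] leaves
    [|z| <= rho]. *)
Lemma spr_perron (R : realType) n (A : 'M[R]_n) rho (v : 'cV[R]_n) :
  (0 < n)%N -> (forall i j, 0 <= A i j) ->
  (forall i, 0 < v i 0) -> A *m v = rho *: v -> spr A = rho.
Proof.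
move=> n0 A0 v0 Av; pose i0 := Ordinal n0.
have rho0 : 0 <= rho.
  have := congr1 (fun M : 'cV[R]_n => M i0 0) Av; rewrite !mxE => e.
  by rewrite -(pmulr_lge0 _ (v0 i0)) -e sumr_ge0// => j _; rewrite mulr_ge0// ltW.
have v_neq0 : v != 0.
  by apply/negP => /eqP vE; have := v0 i0; rewrite vE mxE ltxx.
rewrite /spr; set S := [set _ | _ in _].
have Srho : S rho.
  exists (rho%:C)%C => /=; last first.
    by rewrite expr0n/= addr0 sqrtr_sqr ger0_norm.
  by rewrite (eigenvalue_map (real_complex R)) (eigenvalue_col v_neq0 Av).
have ubS : ubound S rho.
  move=> _ [z /eigenvalueP[w wA w0] <-].
  pose a i := ComplexField.Normc.normc (w 0 i).
  have a0 i : 0 <= a i by rewrite /a; case: (w 0 i) => p q /=; exact: sqrtr_ge0.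
  have normc_real (x : R) : 0 <= x -> ComplexField.Normc.normc (x%:C)%C = x.
    by move=> x0; rewrite /= expr0n/= addr0 sqrtr_sqr ger0_norm.
  have az j : ComplexField.Normc.normc z * a j <= \sum_i a i * A i j.
    have := congr1 (fun M : 'rV[R[i]]_n => M 0 j) wA; rewrite !mxE /a.
    rewrite -ComplexField.Normc.normcM => <-.
    elim/big_ind2: _ => [|y1 p1 y2 p2 h1 h2|i _].
    - by rewrite ComplexField.Normc.normc0.
    - by apply: (le_trans (le_normcD _ _)); exact: lerD.
    - by rewrite mxE ComplexField.Normc.normcM normc_real.
  have sp : 0 < \sum_j a j * v j 0.
    have [j wj] : exists j, w 0 j != 0.
      apply/existsP; apply: contraNT w0; rewrite negb_exists => /forallP h.
      by apply/eqP/rowP => i; rewrite mxE; have := h i; rewrite negbK => /eqP.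
    rewrite (bigD1 j)//= ltr_pwDl//.
      rewrite mulr_gt0// lt_def a0 andbT; apply: contra wj => /eqP.
      by move=> /ComplexField.Normc.eq0_normc ->.
    by apply: sumr_ge0 => i _; rewrite mulr_ge0// ltW.
  rewrite -(ler_pM2r sp) mulr_sumr.
  apply: (@le_trans _ _ (\sum_j \sum_i a i * A i j * v j 0)).
    by apply: ler_sum => j _; rewrite mulrA -mulr_suml ler_wpM2r// ltW.
  rewrite exchange_big mulr_sumr/=; apply: ler_sum => i _.
  have := congr1 (fun M : 'cV[R]_n => M i 0) Av; rewrite !mxE => e.
  under eq_bigr do rewrite -mulrA.
  by rewrite -mulr_sumr e mulrCA.
apply/eqP; rewrite eq_le; apply/andP; split.
  by apply: ge_sup; [exists rho|].
by apply: ub_le_sup => //; exists rho.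
Qed.

(* The normalisation [u *m v = 1] makes [v *m u] the spectral projection. *)
Definition perron_pair (R : realType) n (A : 'M[R]_n) (u : 'rV[R]_n)
    (v : 'cV[R]_n) : Prop :=
  [/\ forall i, 0 < u 0 i, forall i, 0 < v i 0, u *m A = spr A *: u,
      A *m v = spr A *: v & u *m v = 1%:M].

Lemma perron_frobenius (R : realType) n (A : 'M[R]_n) :
  (0 < n)%N -> (forall i j, 0 <= A i j) -> irreducible_mx A ->
  0 < spr A /\ exists u v, perron_pair A u v.
Proof.
move=> n0 A0 irrA; pose i0 := Ordinal n0.
have [rho rho0 [u u0 uA]] := perron_left n0 A0 irrA.
have [||rho' _ [w w0 wA]] := @perron_left _ _ A^T n0.
- by move=> i j; rewrite mxE.
- exact: irreducible_tr.
have s0 : 0 < (u *m w^T) 0 0.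
  rewrite mxE (bigD1 i0)//= ltr_pwDl ?mxE ?mulr_gt0// sumr_ge0// => i _.
  by rewrite mxE mulr_ge0// ltW.
have Av : A *m w^T = rho' *: w^T.
  by apply: trmx_inj; rewrite trmx_mul trmxK wA -linearZ/= trmxK.
have rhoE : rho = rho'.
  have : u *m A *m w^T = u *m (A *m w^T) by rewrite mulmxA.
  rewrite uA Av -scalemxAl -scalemxAr => /(congr1 (fun M : 'M[R]_1 => M 0 0)).
  by rewrite mxE [RHS]mxE => /mulIf; apply; rewrite gt_eqF.
rewrite -rhoE in Av.
have w0' i : 0 < w^T i 0 by rewrite mxE.
have sprE : spr A = rho by exact: spr_perron w0' Av.
rewrite sprE; split=> //; exists u, (((u *m w^T) 0 0)^-1 *: w^T).
split; rewrite ?sprE//.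
- by move=> i; rewrite mxE mulr_gt0// invr_gt0.
- by rewrite -scalemxAr Av !scalerA mulrC.
- by rewrite -scalemxAr {2}[u *m w^T]mx11_scalar scale_scalar_mx mulVf// gt_eqF.
Qed.

(** * Differentiability of the spectral radius *)

Lemma unitmx_ker0 (F : fieldType) n (B : 'M[F]_n) :
  (forall x : 'cV[F]_n, B *m x = 0 -> x = 0) -> B \in unitmx.
Proof.
move=> kB; rewrite -unitmx_tr -row_free_unit -kermx_eq0.
apply/eqP/row_matrixP => i; rewrite row0; apply: trmx_inj; rewrite trmx0.
apply: kB; rewrite -{1}[B]trmxK -trmx_mul -row_mul mulmx_ker.
by rewrite row0 trmx0.
Qed.

(** A kernel vector is killed by [u], hence is an eigenvector of [A], hence a multiple of [v], hence
    0. The inverse serves twice: for the continuity of eigenvectors and for summing powers. *)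
Lemma perron_deflation_unit (R : realType) n (A : 'M[R]_n) u v :
  (forall i j, 0 <= A i j) -> irreducible_mx A -> perron_pair A u v ->
  A - (spr A)%:M + v *m u \in unitmx.
Proof.
move=> A0 irrA [u0 v0 uA Av uv]; apply: unitmx_ker0 => x Bx.
have ux : u *m x = 0.
  have := congr1 (mulmx u) Bx; rewrite mulmx0 mulmxA mulmxDr mulmxBr uA.
  by rewrite mul_mx_scalar subrr add0r mulmxA uv mul1mx.
have Ax : A *m x = spr A *: x.
  move: Bx; rewrite mulmxDl -mulmxA ux mulmx0 addr0 mulmxBl mul_scalar_mx.
  exact: subr0_eq.
have [c xE] := perron_simple A0 irrA v0 Av Ax.
move: ux; rewrite xE -scalemxAr uv scale_scalar_mx mulr1.
by move=> /(congr1 (fun M : 'M[R]_1 => M 0 0)); rewrite !mxE mulr1n => ->; rewrite scale0r.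
Qed.

Lemma is_derive1P (R : realType) (f : R -> R) (x df : R) :
  is_derive x 1 f df <-> h^-1 * (f (h + x) - f x) @[h --> 0^'] --> df.
Proof.
have E : (fun h : R => h^-1 *: (f (h *: (1 : R) + x) - f x)) =
         (fun h : R => h^-1 * (f (h + x) - f x)).
  by apply/funext => h; rewrite [h *: _]mulr1.
split=> [[dfx <-]|fx].
  by move: dfx; rewrite /derivable /derive E.
apply: DeriveDef; rewrite /derivable /derive E; first by apply/cvg_ex; exists df.
exact/cvg_lim.
Qed.

Lemma cvgr_sum0 (R : realType) (T : Type) (F : set_system T) (FF : Filter F)
    (I : Type) (r : seq I) (f : I -> T -> R) :
  (forall i, f i x @[x --> F] --> 0) -> \sum_(i <- r) f i x @[x --> F] --> 0.
Proof.
by move=> f0; have := cvgr_sum FF (r := r) f0; rewrite big1.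
Qed.

Lemma cvgr0_bounded (R : realType) (T : Type) (F : set_system T) (FF : Filter F)
    (f g : T -> R) (K : R) :
  f x @[x --> F] --> 0 -> (forall x, `|g x| <= K) ->
  f x * g x @[x --> F] --> 0.
Proof.
move=> f0 gK; apply/norm_cvg0P.
apply: (@squeeze_cvgr _ _ _ _ (fun=> 0) (fun x => `|f x| * K)).
- by near=> x; rewrite normr_ge0 normrM ler_wpM2l.
- exact: cvg_cst.
- rewrite -[X in _ --> X](mul0r K); apply: cvgMr_tmp.
  by apply/norm_cvg0P.
Unshelve. all: by end_near. Qed.

(* With [u] the left eigenvector at [y0] and [w h] the right one at [y0 + h],
   scaled so that [u *m w h = 1], [spr (A (h + y0)) - spr (A y0)] equals
   [u *m (A (h + y0) - A y0) *m w h]; only the convergence of [w h] is at stake,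
   and it follows from the invertibility of the deflated matrix. *)
Lemma is_derive_spr (R : realType) n (A : R -> 'M[R]_n) (y0 : R) (dA : 'M[R]_n) u v :
  (0 < n)%N -> (forall y i j, 0 <= A y i j) -> (forall y, irreducible_mx (A y)) ->
  perron_pair (A y0) u v ->
  (forall i j, is_derive y0 1 (fun y => A y i j) (dA i j)) ->
  is_derive y0 1 (fun y => spr (A y)) ((u *m dA *m v) 0 0).
Proof.
move=> n0 A0 irrA uvP derA; have [u0 v0 uA Av uv] := uvP.
have /choice[w wP] : forall h, exists w : 'cV[R]_n,
    [/\ forall i, 0 < w i 0, A (h + y0) *m w = spr (A (h + y0)) *: w & u *m w = 1%:M].
  move=> h; have [_ [_ [w [_ w0 _ Aw _]]]] := perron_frobenius n0 (A0 (h + y0)) (irrA _).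
  have s0 : 0 < (u *m w) 0 0.
    rewrite mxE (bigD1 (Ordinal n0))//= ltr_pwDl ?mulr_gt0// sumr_ge0// => i _.
    by rewrite mulr_ge0// ltW.
  exists (((u *m w) 0 0)^-1 *: w); split.
  - by move=> i; rewrite mxE mulr_gt0// invr_gt0.
  - by rewrite -scalemxAr Aw !scalerA mulrC.
  - by rewrite -scalemxAr {2}[u *m w]mx11_scalar scale_scalar_mx mulVf// gt_eqF.
(* All terms of [u *m w h = 1] are nonnegative, so each is at most 1; this bound is uniform in
   [h]. *)
have wK i h : `|w h i 0| <= (u 0 i)^-1.
  have [w0 _ uw] := wP h; rewrite gtr0_norm// -[leRHS]mulr1 ler_pdivlMl//.
  have := congr1 (fun M : 'M[R]_1 => M 0 0) uw; rewrite !mxE mulr1n => <-.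
  by rewrite (bigD1 i)//= lerDl sumr_ge0// => j _; rewrite mulr_ge0// ltW.
pose E h := A (h + y0) - A y0.
have E0 i j : E h i j @[h --> 0^'] --> 0.
  have /is_derive1P Eij := derA i j.
  apply: (@cvg_trans _ (h * (h^-1 * (A (h + y0) i j - A y0 i j)) @[h --> 0^'])).
    apply: near_eq_cvg; near=> h; rewrite mulVKf ?mxE//.
    by near: h; exact: nbhs_dnbhs_neq.
  have : h * (h^-1 * (A (h + y0) i j - A y0 i j)) @[h --> 0^'] --> 0 * dA i j.
    by apply: cvgM Eij; exact: (@nbhs_dnbhs R 0).
  by rewrite mul0r.
have rhoE h : spr (A (h + y0)) - spr (A y0) = (u *m E h *m w h) 0 0.
  have [_ Aw uw] := wP h.
  have -> : u *m E h *m w h = (spr (A (h + y0)) - spr (A y0)) *: 1%:M.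
    by rewrite /E mulmxBr mulmxBl -mulmxA Aw uA -scalemxAr -scalemxAl uw scalerBl.
  by rewrite mxE [X in _ * X]mxE mulr1.
have rhoEs h : spr (A (h + y0)) - spr (A y0) = \sum_j (\sum_i u 0 i * E h i j) * w h j 0.
  by rewrite rhoE mxE; apply: eq_bigr => j _; congr (_ * _); rewrite mxE.
have rho0 : spr (A (h + y0)) - spr (A y0) @[h --> 0^'] --> 0.
  rewrite (eq_cvg _ _ rhoEs).
  apply: cvgr_sum0 => j; apply: cvgr0_bounded (wK j).
  apply: cvgr_sum0 => i; rewrite -[X in _ --> X](mulr0 (u 0 i)).
  by apply: cvgMl_tmp; exact: E0.
have wv i : w h i 0 @[h --> 0^'] --> v i 0.
  have Bu := perron_deflation_unit (A0 y0) (irrA y0) uvP.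
  set B := _ + _ in Bu.
  (* The projection part of [B] kills [w h - v], since [u] takes the value 1 on both vectors; the
     two eigenvector equations express the rest by increments that tend to 0. *)
  have wE h : w h - v = invmx B *m ((spr (A (h + y0)) - spr (A y0)) *: w h - E h *m w h).
    have [_ Aw uw] := wP h.
    have e1 : v *m u *m (w h - v) = 0 by rewrite -mulmxA mulmxBr uw uv subrr mulmx0.
    have e2 : A y0 *m (w h - v) = A y0 *m w h - spr (A y0) *: v by rewrite mulmxBr Av.
    have e3 : (spr (A y0))%:M *m (w h - v) = spr (A y0) *: w h - spr (A y0) *: v.
      by rewrite mul_scalar_mx scalerBr.
    have e4 : E h *m w h = spr (A (h + y0)) *: w h - A y0 *m w h.
      by rewrite /E mulmxBl Aw.
    have <- : B *m (w h - v) = (spr (A (h + y0)) - spr (A y0)) *: w h - E h *m w h.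
      rewrite /B mulmxDl mulmxBl e1 e2 e3 e4 scalerBl addr0 !opprB addrA subrK.
      by rewrite [RHS]addrC addrA subrK.
    by rewrite mulKmx.
  have wiE h : w h i 0 - v i 0 =
      \sum_j invmx B i j * ((spr (A (h + y0)) - spr (A y0)) * w h j 0 - \sum_k E h j k * w h k 0).
    have -> : w h i 0 - v i 0 = (w h - v) i 0 by rewrite !mxE.
    rewrite wE mxE; apply: eq_bigr => j _; congr (_ * _).
    by rewrite [LHS]mxE; congr (_ + _); rewrite [LHS]mxE//; congr (- _); rewrite [LHS]mxE.
  apply/subr_cvg0.
  rewrite (eq_cvg _ _ wiE).
  apply: cvgr_sum0 => j; rewrite -[X in _ --> X](mulr0 (invmx B i j)); apply: cvgMl_tmp.
  rewrite -[X in _ --> X](subr0 0); apply: cvgB; first exact: cvgr0_bounded (wK j).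
  by apply: cvgr_sum0 => k; apply: cvgr0_bounded (wK k).
apply/is_derive1P.
have qE h : h^-1 * (spr (A (h + y0)) - spr (A y0)) =
    \sum_j (\sum_i u 0 i * (h^-1 * (A (h + y0) i j - A y0 i j))) * w h j 0.
  rewrite rhoEs mulr_sumr; apply: eq_bigr => j _; rewrite mulrA mulr_sumr.
  by congr (_ * _); apply: eq_bigr => i _; rewrite mulrCA [E h i j]mxE [X in _ + X]mxE.
rewrite (eq_cvg _ _ qE) mxE; apply: cvgr_sum => j; rewrite mxE; apply: cvgM => //.
apply: cvgr_sum => i; apply: cvgMl_tmp.
by have /is_derive1P := derA i j.
Unshelve. all: by end_near. Qed.

(** * Powers of a Perron matrix *)

(** All terms of [B ^+ m *m v = v] are nonnegative, so none exceeds [v i 0]. What matters is that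
    the bound does not depend on [m]. *)
Lemma expmx_le_perron (R : realType) n (B : 'M[R]_n) (v : 'cV[R]_n) :
  (forall i j, 0 <= B i j) -> (forall i, 0 < v i 0) -> B *m v = v ->
  forall m i j, 0 <= (B ^+ m) i j <= v i 0 / v j 0.
Proof.
move=> B0 v0 Bv m i j; rewrite exprmx_ge0//=.
have Bm : B ^+ m *m v = v.
  by rewrite (@expmx_eigen _ _ _ 1) ?expr1n ?scale1r.
have := congr1 (fun M : 'cV[R]_n => M i 0) Bm; rewrite mxE => e.
rewrite ler_pdivlMr// -e (bigD1 j)//= lerDl sumr_ge0// => k _.
by rewrite mulr_ge0 ?exprmx_ge0// ltW.
Qed.

Lemma mulmx_expl (F : pzRingType) n (B Q : 'M[F]_n) m :
  B *m Q = Q -> B ^+ m *m Q = Q.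
Proof.
by move=> BQ; elim: m => [|m IH]; rewrite ?mul1mx// exprSr -mulmxE -mulmxA BQ.
Qed.

Lemma expmxZ (F : comPzRingType) n (c : F) (A : 'M[F]_n) m :
  (c *: A) ^+ m = c ^+ m *: A ^+ m.
Proof.
elim: m => [|m IH]; first by rewrite !expr0 scale1r.
by rewrite !exprS IH -!mulmxE -scalemxAl -scalemxAr scalerA.
Qed.

Lemma normalized_perron (R : realType) n (A B : 'M[R]_n) u v :
  (0 < n)%N -> (forall i j, 0 <= A i j) -> irreducible_mx A -> perron_pair A u v ->
  B = (spr A)^-1 *: A ->
  [/\ forall i j, 0 <= B i j, irreducible_mx B, B *m v = v /\ u *m B = u, spr B = 1
    & perron_pair B u v].
Proof.
move=> n0 A0 irrA [u0 v0 uA Av uv] BE.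
have [s0 _] := perron_frobenius n0 A0 irrA.
have B0 i j : 0 <= B i j by rewrite BE mxE mulr_ge0// invr_ge0 ltW.
have Bv : B *m v = v by rewrite BE -scalemxAl Av scalerA mulVf ?gt_eqF// scale1r.
have uB : u *m B = u by rewrite BE -scalemxAr uA scalerA mulVf ?gt_eqF// scale1r.
have sB : spr B = 1 by apply: (spr_perron n0 B0 v0); rewrite Bv scale1r.
split; [exact: B0| |by split|exact: sB|]; last first.
  by split; rewrite ?sB ?scale1r; [exact: u0|exact: v0|exact: uB|exact: Bv|exact: uv].
move=> i j; have [m m0 Am] := irrA i j; exists m => //.
have -> : B ^+ m = (spr A)^-1 ^+ m *: A ^+ m by rewrite BE expmxZ.
by rewrite mxE mulr_gt0// exprn_gt0// invr_gt0.
Qed.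

(* [B - 1 + v u] is invertible and [\sum_(m < N) B^m] times it telescopes. *)
Lemma cesaro_expmx (R : realType) n (B : 'M[R]_n) u v i j :
  (forall i j, 0 <= B i j) -> irreducible_mx B -> B *m v = v -> u *m B = u ->
  perron_pair B u v -> spr B = 1 ->
  arithmetic_mean (fun m => (B ^+ m) i j) @ \oo --> (v *m u) i j.
Proof.
move=> B0 irrB Bv uB uvP sB; have [u0 v0 _ _ uv] := uvP.
have Du := perron_deflation_unit B0 irrB uvP.
set Q := v *m u in Du *; set D := _ + _ in Du.
have BQ : B *m Q = Q by rewrite mulmxA Bv.
have QB : Q *m B = Q by rewrite -mulmxA uB.
have QQ : Q *m Q = Q by rewrite mulmxA -[v *m u *m v]mulmxA uv mulmx1.
have QD : Q *m D = Q by rewrite mulmxDr mulmxBr QB QQ sB mulmx1 subrr add0r.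
have sumD N : (\sum_(m < N) B ^+ m) *m D = (B ^+ N - 1%:M) + N%:R *: Q.
  elim: N => [|N IH]; first by rewrite big_ord0 mul0mx expr0 subrr scale0r addr0.
  have e1 : B ^+ N *m D = (B ^+ N.+1 - B ^+ N) + Q.
    by rewrite mulmxDr mulmxBr sB mulmx1 (mulmx_expl N BQ) exprSr.
  rewrite big_ord_recr/= mulmxDl IH e1 addrACA -natr1 scalerDl scale1r; congr (_ + _).
  by rewrite addrC addrA subrK.
have QDi : Q *m invmx D = Q by rewrite -[in LHS]QD mulmxK.
have sumE N : \sum_(m < N) B ^+ m = (B ^+ N - 1%:M) *m invmx D + N%:R *: Q.
  by rewrite -[LHS](mulmxK Du) sumD mulmxDl -scalemxAl QDi.
(* Bounds the entry of [(B ^+ N - 1) *m invmx D] for every [N], so the mean of [m + 1] powers is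
   within [K / (m + 1)] of its limit. *)
pose K := \sum_k (v i 0 / v k 0 + (i == k)%:R) * `|invmx D k j|.
apply/subr_cvg0/norm_cvg0P.
apply: (@squeeze_cvgr _ _ _ _ (fun=> 0) (fun m => K * m.+1%:R^-1)).
- near=> m; rewrite normr_ge0/=.
  rewrite /arithmetic_mean/= /series/= big_mkord.
  have -> : \sum_(k < m.+1) (B ^+ k) i j = (\sum_(k < m.+1) B ^+ k) i j by rewrite summxE.
  have -> : (\sum_(k < m.+1) B ^+ k) i j =
      ((B ^+ m.+1 - 1%:M) *m invmx D) i j + m.+1%:R * Q i j.
    by rewrite sumE mxE; congr (_ + _); rewrite mxE.
  rewrite mulrDr mulKf ?pnatr_eq0//.
  rewrite addrK normrM mulrC normfV [`|_%:R|]ger0_norm// ler_wpM2r ?invr_ge0//.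
  rewrite mxE (le_trans (ler_norm_sum _ _ _))//; apply: ler_sum => k _.
  rewrite normrM ler_wpM2r// !mxE (le_trans (ler_normB _ _))// lerD//.
    by have /andP[? ?] := expmx_le_perron B0 v0 Bv m.+1 i k; rewrite ger0_norm.
  by rewrite normr_nat.
- exact: cvg_cst.
- rewrite -[X in _ --> X](mulr0 K); apply: cvgMl_tmp; exact: cvg_harmonic.
Unshelve. all: by end_near. Qed.

Lemma diag_constants_cvg (R : realType) n (A : 'M[R]_n) (c : 'I_n -> R) k :
  0 < spr A -> diag_constants A c ->
  (((spr A)^-1 *: A) ^+ m) k k @[m --> \oo] --> c k.
Proof.
move=> s0 /(_ k) /eqaddoP ck.
apply/cvgrPdist_le => /= e e0.
have d0 : 0 < e / (`|c k| + 1) by rewrite divr_gt0// ltr_wpDl.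
have {ck} := ck _ d0; apply: filterS => m /=.
have sm : 0 < spr A ^+ m by rewrite exprn_gt0.
rewrite expmxZ mxE exprVn [X in _ -> X <= _]distrC.
rewrite normrM [`|spr A ^+ m|]gtr0_norm// mulrA -ler_pdivrMr// => h.
have -> : (spr A ^+ m)^-1 * (A ^+ m) k k - c k = ((A ^+ m) k k - c k * spr A ^+ m) / spr A ^+ m.
  by rewrite mulrBl mulfK ?gt_eqF// mulrC.
rewrite normrM normfV [`|spr A ^+ m|]gtr0_norm// (le_trans h)//.
rewrite mulrAC ler_pdivrMr ?ltr_wpDl// ler_wpM2l ?ltW//.
by rewrite ltrDl.
Qed.

(** The hypothesis makes the normalised diagonal entries converge, and a convergent sequence has the
    same Cesaro limit; the latter is known even for a periodic matrix. *)
Lemma diag_constants_unique (R : realType) n (A : 'M[R]_n) u v (c : 'I_n -> R) :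
  (0 < n)%N -> (forall i j, 0 <= A i j) -> irreducible_mx A -> perron_pair A u v ->
  diag_constants A c -> forall k, c k = v k 0 * u 0 k.
Proof.
move=> n0 A0 irrA uvP cA k; have [s0 _] := perron_frobenius n0 A0 irrA.
have [B0 irrB [Bv uB] sB uvB] := normalized_perron n0 A0 irrA uvP erefl.
have /cesaro h1 := diag_constants_cvg (k := k) s0 cA.
have h2 := cesaro_expmx (i := k) (j := k) B0 irrB Bv uB uvB sB.
rewrite -(cvg_lim _ h1)// (cvg_lim _ h2)//.
by rewrite mxE big_ord1.
Qed.

(* Some power is [B^m = d Q + (1 - d) E] with [d > 0] and [E >= 0] fixing [v] and [u];
   hence [B^(m k) - Q = (1 - d)^k (E^k - Q)], with [E^k] bounded. *)
Lemma primitive_cvg (R : realType) n (B : 'M[R]_n) (u : 'rV[R]_n) (v : 'cV[R]_n) :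
  (forall i j, 0 <= B i j) -> primitive_mx B ->
  (forall i, 0 < u 0 i) -> (forall i, 0 < v i 0) -> B *m v = v -> u *m B = u ->
  u *m v = 1%:M ->
  forall i j, (B ^+ m) i j @[m --> \oo] --> (v *m u) i j.
Proof.
move=> B0 [m m0 Bm] u0 v0 Bv uB uv.
set Q := v *m u.
have Q0 i j : 0 < Q i j by rewrite mxE big_ord1 mulr_gt0.
have BQ : B *m Q = Q by rewrite mulmxA Bv.
have QB : Q *m B = Q by rewrite -mulmxA uB.
have QQ : Q *m Q = Q by rewrite mulmxA -[v *m u *m v]mulmxA uv mulmx1.
(* The largest multiple of [Q] that fits below [B ^+ m], capped by one half to keep [1 - d]
   positive. *)
pose d := \big[Num.min/2^-1]_ij ((B ^+ m) ij.1 ij.2 / Q ij.1 ij.2).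
have d0 : 0 < d by apply: lt_bigmin => [|ij _]; rewrite ?invr_gt0// divr_gt0.
have d1 : d < 1.
  by apply: (@le_lt_trans _ _ 2^-1); [exact: bigmin_le_id|rewrite invf_lt1// ltr1n].
have dQ i j : d * Q i j <= (B ^+ m) i j.
  by rewrite -ler_pdivlMr//; exact: (@bigmin_le _ _ _ _ (i, j)).
pose E := (1 - d)^-1 *: (B ^+ m - d *: Q).
have d1' : 0 < 1 - d by rewrite subr_gt0.
have E0 i j : 0 <= E i j.
  have -> : E i j = (1 - d)^-1 * ((B ^+ m) i j - d * Q i j) by rewrite !mxE.
  by rewrite mulr_ge0// ?subr_ge0// invr_ge0 ltW.
have BmE : B ^+ m = d *: Q + (1 - d) *: E.
  by rewrite scalerA mulfV ?gt_eqF// scale1r addrC subrK.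
have BmQ k : B ^+ k *m Q = Q by exact: mulmx_expl.
have Qv : Q *m v = v by rewrite -mulmxA uv mulmx1.
have Ev : E *m v = v.
  rewrite -scalemxAl mulmxBl -scalemxAl Qv.
  have -> : B ^+ m *m v = v by rewrite (@expmx_eigen _ _ _ 1) ?expr1n ?scale1r.
  by rewrite -{1}[v]scale1r -scalerBl scalerA mulVf ?gt_eqF// scale1r.
have EQ : E *m Q = Q by rewrite /Q mulmxA Ev.
have QE : Q *m E = Q.
  rewrite -scalemxAr mulmxBr -scalemxAr QQ.
  have -> : Q *m B ^+ m = Q.
    by elim: (m) => [|k IH]; rewrite ?mulmx1// exprS -mulmxE mulmxA QB.
  by rewrite -{1}[Q]scale1r -scalerBl scalerA mulVf ?gt_eqF// scale1r.
clearbody E.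
have QEk k : Q *m E ^+ k = Q.
  by elim: k => [|k IH]; rewrite ?mulmx1// exprS -mulmxE mulmxA QE.
have decay k : (B ^+ m) ^+ k - Q = (1 - d) ^+ k *: (E ^+ k - Q).
  elim: k => [|k IH]; first by rewrite !expr0 scale1r.
  have -> : (B ^+ m) ^+ k.+1 - Q = B ^+ m *m ((B ^+ m) ^+ k - Q).
    by rewrite exprS -mulmxE mulmxBr BmQ.
  rewrite IH -scalemxAr [X in X *m _]BmE mulmxDl -!scalemxAl !mulmxBr QEk QQ subrr.
  have -> : E *m E ^+ k = E ^+ k.+1 by rewrite exprS mulmxE.
  by rewrite scaler0 add0r EQ scalerA -exprSr.
move=> i j.
pose K := \sum_k v i 0 / v k 0 * (v k 0 / v j 0 + Q k j).
have K0 : 0 <= K.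
  by apply: sumr_ge0 => k _; rewrite mulr_ge0 ?addr_ge0 ?divr_ge0// ltW.
(* Split [l] as [m (l %/ m) + l %% m]: the remainder contributes a bounded factor, the quotient the
   decay. *)
have bound l : `|(B ^+ l) i j - Q i j| <= (1 - d) ^+ (l %/ m) * K.
  have -> : (B ^+ l) i j - Q i j =
      \sum_k (B ^+ (l %% m)) i k * ((1 - d) ^+ (l %/ m) * ((E ^+ (l %/ m)) k j - Q k j)).
    have -> : (B ^+ l) i j - Q i j = (B ^+ l - Q) i j by rewrite !mxE.
    have -> : B ^+ l - Q = B ^+ (l %% m) *m ((B ^+ m) ^+ (l %/ m) - Q).
      by rewrite mulmxBr BmQ -exprM mulmxE -exprD {1}(divn_eq l m) addnC mulnC.
    rewrite decay [LHS]mxE; apply: eq_bigr => k _; congr (_ * _).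
    by rewrite [LHS]mxE; congr (_ * _); rewrite !mxE.
  rewrite mulr_sumr (le_trans (ler_norm_sum _ _ _))//; apply: ler_sum => k _.
  have /andP[b0 b1] := expmx_le_perron B0 v0 Bv (l %% m) i k.
  have /andP[e0 e1] := expmx_le_perron E0 v0 Ev (l %/ m) k j.
  have p0 : 0 <= (1 - d) ^+ (l %/ m) by rewrite exprn_ge0// ltW.
  rewrite mulrCA normrM (ger0_norm p0) ler_wpM2l// normrM (ger0_norm b0) ler_pM//.
  rewrite (le_trans (ler_normB _ _))// (ger0_norm e0) (gtr0_norm (Q0 k j)).
  by rewrite lerD2r.
apply/cvgrPdist_le => /= e e0.
have [N HN] : exists N, (1 - d) ^+ N * K <= e.
  have /cvgrPdist_le/(_ e e0)[N _ /(_ N (leqnn N))] :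
      (1 - d) ^+ k * K @[k --> \oo] --> 0.
    rewrite -[X in _ --> X](mul0r K); apply: cvgMr_tmp; apply: cvg_expr.
    by rewrite ger0_norm ?ltW// gtrBl.
  rewrite sub0r normrN => h; exists N; apply: le_trans h; exact: ler_norm.
near=> l; rewrite distrC (le_trans (bound l))// (le_trans _ HN)// ler_wpM2r//.
apply: ler_wiXn2l; [exact: ltW|by rewrite gerBl ltW|].
rewrite leq_divRL//; near: l; exact: nbhs_infty_ge.
Unshelve. all: by end_near. Qed.

Lemma primitive_diag_constants (R : realType) n (A : 'M[R]_n) u v :
  (0 < n)%N -> (forall i j, 0 <= A i j) -> irreducible_mx A -> perron_pair A u v ->
  primitive_mx A -> diag_constants A (fun k => v k 0 * u 0 k).
Proof.
move=> n0 A0 irrA uvP [m m0 Am] k.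
have [s0 _] := perron_frobenius n0 A0 irrA.
pose B := (spr A)^-1 *: A.
have [B0 irrB [Bv uB] sB [u0 v0 _ _ uv]] := normalized_perron n0 A0 irrA uvP (erefl B).
have Bm i j : 0 < (B ^+ m) i j by rewrite expmxZ mxE mulr_gt0// exprn_gt0// invr_gt0.
have BQ := primitive_cvg B0 (ex_intro2 _ _ m m0 Bm) u0 v0 Bv uB uv (i := k) (j := k).
apply/eqaddoP => e e0.
have c0 : 0 < v k 0 * u 0 k by rewrite mulr_gt0.
have /cvgrPdist_le/(_ (e * (v k 0 * u 0 k))) := BQ.
rewrite mulr_gt0// => /(_ isT); apply: filterS => l /=.
have sl : 0 < spr A ^+ l by rewrite exprn_gt0.
rewrite expmxZ [X in _ - X]mxE [X in `|X - _|]mxE big_ord1 exprVn distrC => h.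
rewrite -[X in `|X| <= _]/((A ^+ l) k k - v k 0 * u 0 k * spr A ^+ l).
have -> : (A ^+ l) k k - v k 0 * u 0 k * spr A ^+ l =
    ((spr A ^+ l)^-1 * (A ^+ l) k k - v k 0 * u 0 k) * spr A ^+ l.
  by rewrite mulrBl [_^-1 * _]mulrC mulfVK ?gt_eqF.
by rewrite normrM [X in _ <= _ * X]normrM (gtr0_norm c0) mulrA ler_wpM2r.
Qed.

(** * Large deviations from exponential moments *)

Lemma limn_esup_le_near (R : realType) (u : (\bar R)^nat) (l : R) :
  (forall e, 0 < e -> \forall n \near \oo, (u n <= (l + e)%:E)%E) ->
  (limn_esup u <= l%:E)%E.
Proof.
move=> ul; apply/lee_addgt0Pr => e e0.
have [N _ uN] := ul e e0.
rewrite /limn_esup limf_esupE.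
apply: (@le_trans _ _ (ereal_sup (u @` [set n | (N <= n)%N]))).
  by apply: ereal_inf_lbound; exists [set n | (N <= n)%N] => //; exists N.
by apply: ge_ereal_sup => _ [n Nn <-]; exact: uN.
Qed.

Lemma limn_einf_ge_near (R : realType) (u : (\bar R)^nat) (l : R) :
  (forall e, 0 < e -> \forall n \near \oo, ((l - e)%:E <= u n)%E) ->
  (l%:E <= limn_einf u)%E.
Proof.
move=> ul.
have -> : limn_einf u = (- limn_esup (fun n => - u n))%E.
  by rewrite -[in RHS]limn_einfN; congr limn_einf; apply/funext => n /=; rewrite oppeK.
rewrite leeNr -EFinN; apply: limn_esup_le_near => e e0.
have := ul e e0; apply: filterS => n un.
by rewrite leeNl -EFinN opprD opprK.
Qed.

(* Here and below, [s t] is meant to list the support of [D t]. *)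
Definition mgf (R : realType) (D : nat -> int -> nat) (s : nat -> seq int)
  (t : nat) (y : R) : R := \sum_(x <- s t) (D t x)%:R * expR (y * x%:~R).

Definition window_mass (R : realType) (D : nat -> int -> nat) (s : nat -> seq int)
    (alpha eps : R) (t : nat) : R :=
  \sum_(x <- s t | `|x%:~R / t%:R - alpha| < eps) (D t x)%:R.

Definition mass_growth (R : realType) (D : nat -> int -> nat) (s : nat -> seq int)
    (alpha eps : R) (t : nat) : \bar R :=
  ((t%:R^-1)%:E * lne (window_mass D s alpha eps t)%:E)%E.

(** A strong form of the hypothesis of the Gaertner-Ellis theorem. It carries all the information
    about [D] that enters the estimates below. *)
Definition mgf_growth (R : realType) (D : nat -> int -> nat) (s : nat -> seq int)
    (Lam : R -> R) : Prop :=
  forall y, exists c C : R, 0 < c /\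
    forall t, c * expR (t%:R * Lam y) <= mgf D s t y <= C * expR (t%:R * Lam y).

Lemma window_mass_le (R : realType) D s (alpha alpha' eps eps' : R) t :
  `|alpha' - alpha| + eps' <= eps ->
  window_mass D s alpha' eps' t <= window_mass D s alpha eps t.
Proof.
move=> le; rewrite /window_mass big_mkcond [leRHS]big_mkcond; apply: ler_sum => x _.
case: ifP => h; last by case: ifP => // _; rewrite ler0n.
rewrite ifT// (lt_le_trans _ le)// -[_ / _](subrK alpha') -addrA.
by rewrite (le_lt_trans (ler_normD _ _))// [ltLHS]addrC ltrD2l.
Qed.

Lemma window_mass_chernoff (R : realType) D s (alpha eps y : R) t : (0 < t)%N ->
  window_mass D s alpha eps t <=
  mgf D s t y * expR (t%:R * (- y * alpha + `|y| * eps)).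
Proof.
move=> t0; have t0' : 0 < t%:R :> R by rewrite ltr0n.
rewrite /window_mass big_mkcond /mgf mulr_suml; apply: ler_sum => x _.
case: ifP => h; last by rewrite !mulr_ge0 ?expR_ge0.
rewrite -mulrA ler_peMr// -expRD -[leLHS]expR0 ler_expR.
have -> : y * x%:~R + t%:R * (- y * alpha + `|y| * eps) =
    t%:R * (y * (x%:~R / t%:R - alpha) + `|y| * eps).
  by field; rewrite gt_eqF.
rewrite mulr_ge0// -lerBlDr sub0r.
apply: (@le_trans _ _ (- `|y * (x%:~R / t%:R - alpha)|)); last by rewrite lerNl -normrN ler_norm.
by rewrite lerN2 normrM ler_wpM2l// ltW.
Qed.

(** Undoes the exponential tilting inside the window, at a cost [|y| eps] in the rate that
    disappears with the width of the window. *)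
Lemma window_mass_upper (R : realType) D s (alpha eps y : R) t : (0 < t)%N ->
  \sum_(x <- s t | `|x%:~R / t%:R - alpha| < eps) (D t x)%:R * expR (y * x%:~R) <=
  window_mass D s alpha eps t * expR (t%:R * (y * alpha + `|y| * eps)).
Proof.
move=> t0; have t0' : 0 < t%:R :> R by rewrite ltr0n.
rewrite /window_mass mulr_suml; apply: ler_sum => x h.
rewrite ler_wpM2l// ler_expR.
have -> : y * x%:~R = t%:R * (y * alpha + y * (x%:~R / t%:R - alpha)).
  by field; rewrite gt_eqF.
rewrite ler_pM2l// lerD2l (le_trans (ler_norm _))// normrM ler_wpM2l//.
exact: ltW.
Qed.

(* Exponential tilting: [Lam (y +- h)] is so close to its tangent at [y] that the
   mass of [D t x e^(y x)] outside the window is exponentially negligible. *)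
Lemma window_mass_lower (R : realType) D s (Lam : R -> R) (y alpha eps : R) :
  mgf_growth D s Lam -> is_derive y 1 Lam alpha -> 0 < eps ->
  exists2 c : R, 0 < c & \forall t \near \oo,
    c * expR (t%:R * (Lam y - y * alpha - `|y| * eps)) <= window_mass D s alpha eps t.
Proof.
move=> ZP /is_derive1P dL e0.
have e20 : 0 < eps / 2 by rewrite divr_gt0.
(* A further tilt by [h] gains [h * eps] in the rate outside the window, and the tangent
   approximation gives back at most half of it; the other half makes both tails decay. *)
have [h [h0 hp hm]] : exists h, [/\ 0 < h,
    Lam (y + h) <= Lam y + h * alpha + h * (eps / 2) &
    Lam (y - h) <= Lam y - h * alpha + h * (eps / 2)].
  have /cvgrPdist_le/(_ _ e20) := dL; rewrite near_withinE => -[r /= r0 hr].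
  have r2 : 0 < r / 2 by rewrite divr_gt0.
  have key (k : R) : `|k| = r / 2 -> `|Lam (k + y) - Lam y - k * alpha| <= r / 2 * (eps / 2).
    move=> kr; have k0 : k != 0 by rewrite -normr_eq0 kr gt_eqF.
    have kball : ball_ [eta Num.norm] 0 r k.
      by rewrite /ball_/= sub0r normrN kr ltr_pdivrMr// ltr_pMr// ltr1n.
    have -> : Lam (k + y) - Lam y - k * alpha = - (k * (alpha - k^-1 * (Lam (k + y) - Lam y))).
      by field.
    by rewrite normrN normrM kr ler_wpM2l ?(ltW r2)// hr.
  exists (r / 2); split=> //.
    have := key _ (gtr0_norm r2); rewrite [_ + y]addrC ler_norml => /andP[_]; lra.
  have := key (- (r / 2)); rewrite normrN (gtr0_norm r2) => /(_ erefl).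
  by rewrite [_ + y]addrC ler_norml => /andP[_]; lra.
have [c [C0 [c0 cb]]] := ZP y; have cP t := andP (cb t).
have [c1 [C1 [_ C1b]]] := ZP (y + h); have C1P t := andP (C1b t).
have [c2 [C2 [_ C2b]]] := ZP (y - h); have C2P t := andP (C2b t).
exists (c / 2); first by rewrite divr_gt0.
have q0 : 0 < h * (eps / 2) by rewrite mulr_gt0.
have small : \forall t \near \oo, (`|C1| + `|C2|) * expR (- (t%:R * (h * (eps / 2)))) <= c / 2.
  near=> t.
  rewrite -mulrN expRM_natl; near: t.
  have : (`|C1| + `|C2|) * expR (- (h * (eps / 2))) ^+ t @[t --> \oo] --> 0.
    rewrite -[X in _ --> X](mulr0 (`|C1| + `|C2|)); apply: cvgMl_tmp; apply: cvg_expr.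
    by rewrite gtr0_norm ?expR_gt0// expR_lt1 oppr_lt0.
  move=> /cvgr0_norm_le/(_ (c / 2)); rewrite divr_gt0// => /(_ isT).
  by apply: filterS => t; apply: le_trans; exact: ler_norm.
near=> t.
have t0 : (0 < t)%N by near: t; exact: nbhs_infty_gt.
have t0' : 0 < t%:R :> R by rewrite ltr0n.
have sm : (`|C1| + `|C2|) * expR (- (t%:R * (h * (eps / 2)))) <= c / 2 by near: t.
set I := \sum_(x <- s t | `|x%:~R / t%:R - alpha| < eps) (D t x)%:R * expR (y * x%:~R) : R.
(* Outside the window [x / t] is at least [alpha + eps] or at most [alpha - eps], and there the term
   is dominated by its tilt by [h] or by [- h]. *)
have split_sum : mgf D s t y <= I
    + mgf D s t (y + h) * expR (- (t%:R * (h * (alpha + eps))))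
    + mgf D s t (y - h) * expR (t%:R * (h * (alpha - eps))).
  rewrite /mgf /I !mulr_suml [X in X + _ + _]big_mkcond -!big_split/=.
  apply: ler_sum => x _; rewrite -!mulrA -!expRD.
  case: ifPn => [_|].
    by rewrite -addrA lerDl addr_ge0// mulr_ge0// expR_ge0.
  rewrite -leNgt add0r -mulrDr => out; rewrite ler_wpM2l//.
  have xE : x%:~R = t%:R * (x%:~R / t%:R) :> R by field; rewrite gt_eqF.
  set z := x%:~R / t%:R in out xE; rewrite xE.
  move: out; rewrite ler_normr => /orP[out|out].
    rewrite -[leLHS]addr0 lerD ?expR_ge0// ler_expR.
    have : 0 <= t%:R * h * (z - (alpha + eps)) by apply: mulr_ge0; [exact: mulr_ge0 (ltW t0') (ltW h0)|lra].
    by lra.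
  rewrite -[leLHS]add0r lerD ?expR_ge0// ler_expR.
  have : 0 <= t%:R * h * ((alpha - eps) - z) by apply: mulr_ge0; [exact: mulr_ge0 (ltW t0') (ltW h0)|lra].
  by lra.
have tailp : mgf D s t (y + h) * expR (- (t%:R * (h * (alpha + eps)))) <=
    `|C1| * expR (- (t%:R * (h * (eps / 2)))) * expR (t%:R * Lam y).
  apply: (@le_trans _ _ (`|C1| * expR (t%:R * Lam (y + h)) * expR (- (t%:R * (h * (alpha + eps)))))).
    rewrite ler_wpM2r ?expR_ge0// (le_trans (C1P t).2)// ler_wpM2r ?expR_ge0//.
    exact: ler_norm.
  rewrite -!mulrA ler_wpM2l// -!expRD ler_expR.
  have : t%:R * Lam (y + h) <= t%:R * (Lam y + h * alpha + h * (eps / 2)) by rewrite ler_pM2l.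
  by lra.
have tailm : mgf D s t (y - h) * expR (t%:R * (h * (alpha - eps))) <=
    `|C2| * expR (- (t%:R * (h * (eps / 2)))) * expR (t%:R * Lam y).
  apply: (@le_trans _ _ (`|C2| * expR (t%:R * Lam (y - h)) * expR (t%:R * (h * (alpha - eps))))).
    rewrite ler_wpM2r ?expR_ge0// (le_trans (C2P t).2)// ler_wpM2r ?expR_ge0//.
    exact: ler_norm.
  rewrite -!mulrA ler_wpM2l// -!expRD ler_expR.
  have : t%:R * Lam (y - h) <= t%:R * (Lam y - h * alpha + h * (eps / 2)) by rewrite ler_pM2l.
  by lra.
have Ilow : c / 2 * expR (t%:R * Lam y) <= I.
  have E0 : 0 < expR (t%:R * Lam y) :> R by exact: expR_gt0.
  have := (cP t).1; move: split_sum tailp tailm.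
  set E := expR (t%:R * Lam y) in E0 *; set q := expR (- _) in sm *.
  have : (`|C1| + `|C2|) * q * E <= c / 2 * E by rewrite ler_pM2r.
  by lra.
have Iup := @window_mass_upper R D s alpha eps y t t0.
rewrite -(ler_pM2r (expR_gt0 (t%:R * (y * alpha + `|y| * eps)))).
apply: le_trans Iup; apply: le_trans Ilow.
rewrite -[leLHS]mulrA -expRD (_ : t%:R * (_ - _ - _) + _ = t%:R * Lam y)//; ring.
Unshelve. all: by end_near. Qed.

(** * From bounds on masses to growth rates *)

Lemma mass_growth_ub (R : realType) (w C a e : R) (t : nat) : (0 < t)%N ->
  ln C <= t%:R * e -> 0 < C -> w <= C * expR (t%:R * a) ->
  ((t%:R^-1)%:E * lne w%:E <= (a + e)%:E)%E.
Proof.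
move=> t0 lnC C0 wle; have t0' : 0 < t%:R :> R by rewrite ltr0n.
(* A window without mass has growth [-oo]. *)
have [w0|w0] := leP w 0.
  rewrite le0_lneNy ?lee_fin// gt0_muleNy ?lte_fin ?invr_gt0//.
  exact: leNye.
rewrite lne_EFin// -EFinM lee_fin ler_pdivrMl//.
apply: (@le_trans _ _ (ln (C * expR (t%:R * a)))); first by rewrite ler_ln ?posrE ?mulr_gt0 ?expR_gt0.
by rewrite lnM ?posrE ?expR_gt0// expRK mulrDr addrC lerD2l.
Qed.

Lemma mass_growth_lb (R : realType) (w c a e : R) (t : nat) : (0 < t)%N ->
  - ln c <= t%:R * e -> 0 < c -> c * expR (t%:R * a) <= w ->
  ((a - e)%:E <= (t%:R^-1)%:E * lne w%:E)%E.
Proof.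
move=> t0 lnc c0 wge; have t0' : 0 < t%:R :> R by rewrite ltr0n.
have w0 : 0 < w by apply: lt_le_trans wge; rewrite mulr_gt0 ?expR_gt0.
rewrite lne_EFin// -EFinM lee_fin ler_pdivlMl//.
apply: (@le_trans _ _ (ln (c * expR (t%:R * a)))); last by rewrite ler_ln ?posrE ?mulr_gt0 ?expR_gt0.
by rewrite lnM ?posrE ?expR_gt0// expRK mulrBr addrC lerD2r lerNl.
Qed.

Lemma near_natr_ge (R : realType) (e K : R) : 0 < e ->
  \forall t \near \oo, K <= t%:R * e.
Proof.
move=> e0; near=> t; rewrite -ler_pdivrMr//.
by near: t; exact: nbhs_infty_ger.
Unshelve. all: by end_near. Qed.

Lemma mass_growth_limsup (R : realType) D s (Lam : R -> R) (alpha eps y : R) :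
  mgf_growth D s Lam ->
  (limn_esup (mass_growth D s alpha eps) <= (- y * alpha + Lam y + `|y| * eps)%:E)%E.
Proof.
move=> ZP; have [c [C [c0 cC]]] := ZP y.
have cCt t := andP (cC t).
have C0 : 0 < C.
  rewrite -(pmulr_lgt0 _ (expR_gt0 (0%:R * Lam y))).
  by apply: lt_le_trans (le_trans (cCt 0%N).1 (cCt 0%N).2); rewrite mulr_gt0 ?expR_gt0.
apply: limn_esup_le_near => e e0; near=> t.
have t0 : (0 < t)%N by near: t; exact: nbhs_infty_gt.
apply: (@mass_growth_ub _ _ C) => //.
  by near: t; exact: near_natr_ge.
apply: (le_trans (window_mass_chernoff _ _ _ _ y t0)).
apply: (@le_trans _ _ (C * expR (t%:R * Lam y) * expR (t%:R * (- y * alpha + `|y| * eps)))).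
  by rewrite ler_wpM2r ?expR_ge0//; exact: (cCt t).2.
by rewrite -[leLHS]mulrA -expRD (_ : t%:R * Lam y + _ = t%:R * (- y * alpha + Lam y + `|y| * eps))//; ring.
Unshelve. all: by end_near. Qed.

Lemma mass_growth_liminf_tilt (R : realType) D s (Lam : R -> R) (y alpha alpha' eps m : R) :
  mgf_growth D s Lam -> is_derive y 1 Lam alpha' -> `|alpha' - alpha| < eps ->
  m <= Lam y - y * alpha' ->
  (m%:E <= limn_einf (mass_growth D s alpha eps))%E.
Proof.
move=> ZP dL close my; apply: limn_einf_ge_near => e e0.
(* This radius keeps the window around [alpha'] inside the one around [alpha] and makes the cost
   [|y| r] at most [e / 2]; the [+ 1] covers [y = 0]. *)
pose r := Num.min (eps - `|alpha' - alpha|) (e / 2 / (`|y| + 1)).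
have r0 : 0 < r by rewrite lt_min subr_gt0 close !divr_gt0// ltr_wpDl.
have yr : `|y| * r <= e / 2.
  apply: (@le_trans _ _ (`|y| * (e / 2 / (`|y| + 1)))).
    by rewrite ler_wpM2l// ge_min lexx orbT.
  rewrite mulrA ler_pdivrMr ?ltr_wpDl// mulrC ler_wpM2l//; last by rewrite lerDl.
  by rewrite ltW// divr_gt0.
have [c c0 cW] := window_mass_lower ZP dL r0.
have e20 : 0 < e / 2 by rewrite divr_gt0.
near=> t.
have t0 : (0 < t)%N by near: t; exact: nbhs_infty_gt.
apply: (@le_trans _ _ ((Lam y - y * alpha' - `|y| * r - e / 2)%:E)).
  by rewrite lee_fin; lra.
apply: (@mass_growth_lb _ _ c) => //.
  by near: t; exact: near_natr_ge.
apply: (@le_trans _ _ (window_mass D s alpha' r t)); first by near: t.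
apply: window_mass_le; rewrite addrC -lerBrDr.
by rewrite /r ge_min lexx.
Unshelve. all: by end_near. Qed.

(* A strictly convex quadratic penalty makes the infimum of [Lam y - y alpha]
   attained at some [y], where the slope [Lam' y] differs from [alpha] by at most
   the slope of the penalty. *)
Lemma penalized_minimum (R : realType) (Lam : R -> R) (alpha eps m : R) :
  (forall y, derivable Lam y 1) -> 0 < eps -> (forall y, m <= Lam y - y * alpha) ->
  exists (y alpha' : R), [/\ is_derive y 1 Lam alpha', `|alpha' - alpha| < eps
    & m <= Lam y - y * alpha'].
Proof.
move=> dL e0 mL.
(* At a minimiser [c] of [g], comparison with [g 0] gives [k / 2 * c ^+ 2 < B], hence
   [(k c)^2 < 2 k B = eps^2 / 2]; this dictates [k]. The [+ 1] makes [B] positive and the bound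
   strict. *)
pose B := Lam 0 - m + 1.
have B0 : 0 < B by have := mL 0; rewrite mul0r subr0 /B; lra.
pose k := eps ^+ 2 / (4 * B).
have k0 : 0 < k by rewrite divr_gt0 ?exprn_gt0// mulr_gt0.
pose g := fun y : R => Lam y - y * alpha + k / 2 * y ^+ 2.
have dg (y : R) : is_derive y 1 g ('D_1 Lam y - alpha + k * y).
  have dLy : is_derive y 1 Lam ('D_1 Lam y) by exact: derivableP.
  rewrite /g; apply: is_derive_eq.
  have scaleE (a b : R) : a *: b = a * b by [].
  by rewrite !scaleE; field.
have B0' := ltW B0; have k0' := ltW k0.
(* At [- K] and [K] the penalty is at least [B], so the minimum over the segment is interior and the
   derivative vanishes there. *)
pose K := 1 + 2 * B / k.
have K1 : 1 <= K by rewrite /K lerDl divr_ge0// mulr_ge0.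
have kK : B <= k / 2 * K ^+ 2.
  apply: (@le_trans _ _ (k / 2 * K)); last first.
    by apply: ler_wpM2l; [exact: divr_ge0|rewrite expr2 ler_peMl// (le_trans ler01)].
  rewrite /K mulrDr (_ : k / 2 * (2 * B / k) = B); last by field; rewrite gt_eqF.
  by rewrite lerDr mulr1 divr_ge0.
have cg : continuous g.
  by move=> y; apply: differentiable_continuous; apply/derivable1_diffP; case: (dg y).
have KK : - K <= K by lra.
have [c cK gmin] := EVT_min KK (continuous_subspaceT cg).
have g0 : g 0 = m + B - 1 by rewrite /g /B mul0r expr0n/= mulr0; ring.
have gc : g c <= m + B - 1 by rewrite -g0; apply: gmin; rewrite in_itv/=; lra.
have cB : k / 2 * c ^+ 2 < B by have := mL c; rewrite /g in gc; lra.
have cI : c \in `]- K, K[%R.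
  move: cK; rewrite !in_itv/= => /andP[c1 c2].
  rewrite !lt_neqAle c1 c2 !andbT; apply/andP; split; apply/negP => /eqP cE.
    by move: cB; rewrite -cE sqrrN; lra.
  by move: cB; rewrite cE; lra.
have dc0 : is_derive c 1 g 0.
  apply: (derive1_at_min KK) cI _ => [t _|t tI]; first by case: (dg t).
  by apply: gmin; move: tI; apply: subset_itvW.
have E : 'D_1 Lam c - alpha + k * c = 0.
  have [_ <-] := dg c; by have [_ ->] := dc0.
exists c, ('D_1 Lam c); split; first exact: derivableP.
- have -> : 'D_1 Lam c - alpha = - (k * c) by lra.
  rewrite normrN -ltr_sqr ?nnegrE ?(ltW e0)// real_normK ?num_real// exprMn.
  have kB : k * (4 * B) = eps ^+ 2 by rewrite /k divfK// gt_eqF// mulr_gt0.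
  have : k * (k / 2 * c ^+ 2) < k * B by rewrite ltr_pM2l.
  have : 0 < k * B by rewrite mulr_gt0.
  rewrite -kB; lra.
(* Replacing [alpha] by the slope at [c] adds [k * c ^+ 2], which is nonnegative. *)
- have -> : 'D_1 Lam c = alpha - k * c by lra.
  have := mL c; have : 0 <= k * c ^+ 2 by rewrite mulr_ge0 ?sqr_ge0.
  by rewrite expr2; nra.
Qed.

(** * The Legendre transform and its maximiser *)

Lemma legendre_le (R : realType) (Lam : R -> R) (alpha y : R) :
  (legendre Lam alpha <= (- y * alpha + Lam y)%:E)%E.
Proof. by apply: ereal_inf_lbound; exists y. Qed.

Lemma mass_growth_liminf (R : realType) D s (Lam : R -> R) (alpha eps : R) :
  mgf_growth D s Lam -> (forall y, derivable Lam y 1) -> 0 < eps ->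
  (legendre Lam alpha <= limn_einf (mass_growth D s alpha eps))%E.
Proof.
move=> ZP dL e0.
have := legendre_le Lam alpha.
case LE : (legendre Lam alpha) => [m| |] mL; last exact: leNye.
  have mL' y : m <= Lam y - y * alpha.
    by rewrite addrC -mulNr -lee_fin; exact: mL.
  have [y [alpha' [dLy close my]]] := penalized_minimum dL e0 mL'.
  exact: mass_growth_liminf_tilt ZP dLy close my.
by have := mL 0.
Qed.

(** The error [|y| eps] is not uniform in [y], so the infima over [y] and over [eps] are exchanged
    instead; as [U] is monotone in [eps], its infimum is its right limit at 0, and [F] is
    squeezed. *)
Lemma cvg_window_legendre (R : realType) (Lam : R -> R) (alpha : R) (F : R -> \bar R) :
  (forall eps, 0 < eps -> (legendre Lam alpha <= F eps)%E) ->
  (forall eps y, 0 < eps -> (F eps <= (- y * alpha + Lam y + `|y| * eps)%:E)%E) ->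
  F eps @[eps --> 0^'+] --> legendre Lam alpha.
Proof.
move=> LF FU.
pose U (eps : R) := ereal_inf [set (- y * alpha + Lam y + `|y| * eps)%:E | y in [set: R]].
have U_ndec : {in `]0, +oo[%R &, {homo U : a b / a <= b >-> (a <= b)%E}}.
  move=> a b _ _ ab; apply: le_ereal_inf_tmp => _ [y _ <-].
  apply: (@le_trans _ _ (- y * alpha + Lam y + `|y| * a)%:E).
    by apply: ereal_inf_lbound; exists y.
  by rewrite lee_fin lerD2l ler_wpM2l.
have UE : ereal_inf [set U x | x in `]0, +oo[%classic] = legendre Lam alpha.
  apply/eqP; rewrite eq_le; apply/andP; split.
    apply: le_ereal_inf_tmp => _ [y _ <-]; apply/lee_addgt0Pr => e e0.
    have d0 : 0 < e / (`|y| + 1) by rewrite divr_gt0// ltr_wpDl.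
    apply: (@le_trans _ _ (U (e / (`|y| + 1)))).
      by apply: ereal_inf_lbound; exists (e / (`|y| + 1)) => //=; rewrite in_itv/= d0.
    apply: (@le_trans _ _ (- y * alpha + Lam y + `|y| * (e / (`|y| + 1)))%:E).
      by apply: ereal_inf_lbound; exists y.
    rewrite -EFinD lee_fin lerD2l mulrA ler_pdivrMr ?ltr_wpDl// mulrC.
    by rewrite ler_wpM2l ?ltW// ltrDl.
  apply: le_ereal_inf_tmp => _ [x /= xI <-].
  have x0 : 0 < x by move: xI; rewrite in_itv/= andbT.
  apply: (le_trans (LF x x0)); apply: le_ereal_inf_tmp => _ [y _ <-].
  exact: FU.
apply: (@squeeze_cvge _ _ _ _ (fun=> legendre Lam alpha) F U).
- near=> eps.
  have e0 : 0 < eps by near: eps; exact: nbhs_right_gt.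
  rewrite LF//=; apply: le_ereal_inf_tmp => _ [y _ <-]; exact: FU.
- exact: cvg_cst.
- by rewrite -UE; apply: (@nondecreasing_at_right_cvge R U 0 +oo%O).
Unshelve. all: by end_near. Qed.

Lemma mass_growth_cvg (R : realType) D s (Lam : R -> R) (alpha : R) :
  mgf_growth D s Lam -> (forall y, derivable Lam y 1) ->
  (limn_esup (mass_growth D s alpha eps) @[eps --> 0^'+] --> legendre Lam alpha) /\
  (limn_einf (mass_growth D s alpha eps) @[eps --> 0^'+] --> legendre Lam alpha).
Proof.
move=> ZP dL; split; apply: cvg_window_legendre => [eps e0|eps y e0].
- by apply: le_trans (limn_einf_sup _); exact: mass_growth_liminf.
- exact: mass_growth_limsup.
- exact: mass_growth_liminf.
- by apply: le_trans (limn_einf_sup _) _; exact: mass_growth_limsup.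
Qed.

(* The mass near the slope [a] grows at least at rate [Lam 0] by tilting at [0], and
   at most at rate [Lam y - y a] for every [y]. *)
Lemma tangent_below (R : realType) D s (Lam : R -> R) (a : R) :
  mgf_growth D s Lam -> is_derive (0 : R) 1 Lam a -> forall y, Lam 0 <= - y * a + Lam y.
Proof.
move=> ZP dL y; apply/ler_addgt0Pr => e e0.
have d0 : 0 < e / (`|y| + 1) by rewrite divr_gt0// ltr_wpDl.
have lo : ((Lam 0)%:E <= limn_einf (mass_growth D s a (e / (`|y| + 1))))%E.
  apply: (mass_growth_liminf_tilt ZP dL); first by rewrite subrr normr0.
  by rewrite mul0r subr0.
have := le_trans lo (le_trans (limn_einf_sup _) (mass_growth_limsup a _ y ZP)).
rewrite lee_fin => /le_trans; apply; rewrite lerD2l mulrA ler_pdivrMr ?ltr_wpDl// mulrC.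
by rewrite ler_wpM2l ?ltW// ltrDl.
Qed.

(** A maximiser [b] has value [Lam 0], so [Lam y - y b] is minimal at [y = 0], where its derivative
    [a - b] must vanish. Uniqueness thus rests on differentiability at 0. *)
Lemma legendre_argmax (R : realType) (Lam : R -> R) (a : R) :
  (forall y, derivable Lam y 1) -> is_derive (0 : R) 1 Lam a ->
  (forall y, Lam 0 <= - y * a + Lam y) ->
  legendre Lam a = (Lam 0)%:E /\
  forall b, (forall beta, (legendre Lam beta <= legendre Lam b)%E) -> b = a.
Proof.
move=> drvL dL aL.
have le0 beta : (legendre Lam beta <= (Lam 0)%:E)%E.
  by have := legendre_le Lam beta 0; rewrite oppr0 mul0r add0r.
have La : legendre Lam a = (Lam 0)%:E.
  apply/eqP; rewrite eq_le le0/=; apply: le_ereal_inf_tmp => _ [y _ <-].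
  by rewrite lee_fin.
split=> // b bmax.
have bL y : Lam 0 <= - y * b + Lam y.
  by rewrite -lee_fin -La; apply: le_trans (bmax a) _; exact: legendre_le.
have dg (y l : R) : is_derive y 1 Lam l -> is_derive y 1 (fun y => - y * b + Lam y) (l - b).
  move=> dLy; apply: is_derive_eq.
  have scaleE (p q : R) : p *: q = p * q by [].
  by rewrite !scaleE; ring.
have /(_ _ _)/= := @derive1_at_min R (fun y => - y * b + Lam y) (-1) 1 0.
have m11 : -1 <= 1 :> R by lra.
move=> /(_ m11); case.
- by move=> t _; have [] := dg t _ (derivableP (drvL t)).
- by rewrite in_itv/=; lra.
- by move=> t _; rewrite oppr0 mul0r add0r.
move=> _ d0; have [_] := dg _ _ dL; rewrite d0 => /eqP.
by rewrite eq_sym subr_eq0 => /eqP.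
Qed.

(** * Defect dynamics *)

Definition shift_config (s : int) (xi : config) : config := fun x => xi (x - s).

Lemma global_map_shift ca s xi :
  global_map ca (shift_config s xi) = shift_config s (global_map ca xi).
Proof.
apply/funext => x; rewrite /global_map /shift_config; congr (local_rule _).
by apply: val_inj => /=; apply: eq_map => v; rewrite addrAC.
Qed.

Lemma flip_shift s xi y : flip (shift_config s xi) y = shift_config s (flip xi (y - s)).
Proof. by apply/funext => x; rewrite /flip /shift_config (inj_eq (addIr _)). Qed.

Lemma change_shift ca s xi y x :
  change ca (shift_config s xi) y x = change ca xi (y - s) (x - s).
Proof. by rewrite /change flip_shift !global_map_shift. Qed.

Lemma trajectory_shift ca s xi t :
  trajectory ca (shift_config s xi) t = shift_config s (trajectory ca xi t).
Proof. by elim: t => //= t IH; rewrite IH global_map_shift. Qed.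

Lemma trajectoryD ca xi m t :
  trajectory ca xi (m + t) = trajectory ca (trajectory ca xi m) t.
Proof. by rewrite /trajectory addnC iterD. Qed.

Lemma defects_shift ca s xi D0 t x :
  defects ca (shift_config s xi) (fun x => D0 (x - s)) t x = defects ca xi D0 t (x - s).
Proof.
elim: t x => //= t IH x; apply: eq_bigr => v _.
by rewrite IH trajectory_shift change_shift addrAC.
Qed.

Lemma defectsD ca xi D0 m t :
  defects ca xi D0 (m + t) = defects ca (trajectory ca xi m) (defects ca xi D0 m) t.
Proof.
elim: t => [|t IH]; first by rewrite addn0.
rewrite addnS /= IH; apply/funext => x; apply: eq_bigr => v _.
by rewrite trajectoryD.
Qed.

(** * Pairings of defect configurations with weights *)

Definition finitely_supported (f : int -> nat) : Prop :=
  exists2 s : seq int, uniq s & forall x, f x != 0%N -> x \in s.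

(** The finitely supported sum is 0 by convention on an infinite support, so the identities below
    ask for a finitely supported [f]; the weight [w] may then be unbounded, such as an
    exponential. *)
Definition pairing (R : realType) (f : int -> nat) (w : int -> R) : R :=
  \sum_(x \in [set: int]) (f x)%:R * w x.

Lemma fsum_seq (R : realType) (s : seq int) (F : int -> R) :
  uniq s -> (forall x, F x != 0 -> x \in s) ->
  \sum_(x \in [set: int]) F x = \sum_(x <- s) F x.
Proof.
move=> us Fs; rewrite [RHS]fsbig_seq//; symmetry; apply: fsbig_widen => // x [_ /= /negP xs].
by apply/eqP; apply: contraNT xs => /Fs.
Qed.

Lemma pairingE (R : realType) f s (w : int -> R) :
  uniq s -> (forall x, f x != 0%N -> x \in s) ->
  pairing f w = \sum_(x <- s) (f x)%:R * w x.
Proof.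
move=> us fs; apply: fsum_seq => // x; rewrite mulf_eq0 negb_or pnatr_eq0.
by case/andP => /fs.
Qed.

Lemma pairing_le (R : realType) f (w1 w2 : int -> R) :
  finitely_supported f -> (forall x, w1 x <= w2 x) -> pairing f w1 <= pairing f w2.
Proof.
move=> [s us fs] w12; rewrite !(pairingE _ us fs); apply: ler_sum => x _.
by rewrite ler_wpM2l.
Qed.

Lemma pairingZ (R : realType) f (c : R) (w : int -> R) :
  finitely_supported f -> pairing f (fun x => c * w x) = c * pairing f w.
Proof.
move=> [s us fs]; rewrite !(pairingE _ us fs) mulr_sumr; apply: eq_bigr => x _.
by rewrite mulrCA.
Qed.

Lemma pairing_ge_term (R : realType) f (w : int -> R) x :
  finitely_supported f -> (forall x, 0 <= w x) -> (f x)%:R * w x <= pairing f w.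
Proof.
move=> [s us fs] w0; rewrite (pairingE _ us fs).
have [->|fx] := eqVneq (f x) 0%N.
  by rewrite mul0r sumr_ge0// => z _; rewrite mulr_ge0.
rewrite (bigD1_seq x) ?fs//= lerDl sumr_ge0// => z _.
by rewrite mulr_ge0.
Qed.

Lemma point_defect_supported a : finitely_supported (point_defect a).
Proof.
exists [:: a] => // x; rewrite /point_defect inE.
by case: (x == a).
Qed.

Lemma pairing_point (R : realType) a (w : int -> R) : pairing (point_defect a) w = w a.
Proof.
rewrite (@pairingE _ _ [:: a])//.
  by rewrite big_seq1 /point_defect eqxx mul1r.
by move=> x; rewrite /point_defect inE; case: (x == a).
Qed.

(* The transpose of one step of the defect dynamics, acting on test functions. *)
Definition step_adjoint (R : realType) ca (xi : config) (w : int -> R) : int -> R :=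
  fun y => \sum_(v <- nbhd ca) (change ca xi y (y - v))%:R * w (y - v).

Fixpoint adjoint (R : realType) ca (xi : config) t (w : int -> R) : int -> R :=
  if t is t'.+1 then adjoint ca xi t' (step_adjoint ca (trajectory ca xi t') w) else w.

Lemma defects_supported ca xi D0 t :
  finitely_supported D0 -> finitely_supported (defects ca xi D0 t).
Proof.
move=> fD; elim: t => //= t [s us fs].
exists (undup [seq x - v | x <- s, v <- nbhd ca]); first exact: undup_uniq.
move=> x; rewrite mem_undup -lt0n lt0n sum_nat_seq_neq0 => /hasP[v vN /=].
rewrite muln_eq0 negb_or => /andP[_ /fs xs].
by apply/allpairsP; exists (x + v, v); rewrite /= addrK.
Qed.

Lemma pairing_step (R : realType) ca xi D0 t (w : int -> R) :
  finitely_supported D0 ->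
  pairing (defects ca xi D0 t.+1) w =
  pairing (defects ca xi D0 t) (step_adjoint ca (trajectory ca xi t) w).
Proof.
move=> fD; have [s us fs] := @defects_supported ca xi D0 t fD.
have [s' us' fs'] := @defects_supported ca xi D0 t.+1 fD.
rewrite (pairingE _ us fs) (pairingE _ us' fs') /=.
under eq_bigr do rewrite natr_sum mulr_suml.
under [RHS]eq_bigr do rewrite mulr_sumr.
rewrite exchange_big [RHS]exchange_big/=; rewrite big_seq [RHS]big_seq; apply: eq_bigr => v vN.
pose F y : R := (defects ca xi D0 t y)%:R *
  ((change ca (trajectory ca xi t) y (y - v))%:R * w (y - v)).
transitivity (\sum_(x <- s') F (x + v)).
  by apply: eq_bigr => x _; rewrite /F addrK natrM mulrA [_%:R * _%:R]mulrC.
(* The lists [s] and [s'] need not be translates of each other; both sums are extended to all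
   integers, where [x + v] is a bijective substitution. *)
rewrite -(fsum_seq (F := fun x => F (x + v)) us') => [|x].
  rewrite -(@fsum_seq _ s F us) => [|x].
    symmetry; apply: (@reindex_fsbigT _ _ _ _ _ (fun x => x + v)).
    by exists (fun x => x - v) => x; rewrite ?addrK ?subrK.
  by rewrite /F mulf_eq0 negb_or pnatr_eq0 => /andP[/fs].
rewrite /F addrK !mulf_eq0 !negb_or !pnatr_eq0 => /and3P[d0 c0 _]; apply: fs'.
rewrite /= sum_nat_seq_neq0; apply/hasP; exists v => //=.
by rewrite muln_eq0 negb_or c0.
Qed.

Lemma pairing_adjoint (R : realType) ca xi D0 t (w : int -> R) :
  finitely_supported D0 ->
  pairing (defects ca xi D0 t) w = pairing D0 (adjoint ca xi t w).
Proof. by move=> fD; elim: t w => //= t IH w; rewrite pairing_step// IH. Qed.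

(** Linearity in the initial defects, obtained by duality: the value of the adjoint weight at [a] is
    the pairing for a single defect at [a]. *)
Lemma pairing_superposition (R : realType) ca xi D0 t (w : int -> R) :
  finitely_supported D0 ->
  pairing (defects ca xi D0 t) w =
  pairing D0 (fun a => pairing (defects ca xi (point_defect a) t) w).
Proof.
move=> fD; rewrite pairing_adjoint//; congr pairing; apply/funext => a.
by rewrite pairing_adjoint ?pairing_point//; exact: point_defect_supported.
Qed.

(** A crude bound, meant for the times between multiples of [p0]. The summand 1 makes the constant
    at least 1, so that its powers increase. *)
Lemma pairing_expR_step (R : realType) ca xi D0 t (y : R) : finitely_supported D0 ->
  pairing (defects ca xi D0 t.+1) (fun x => expR (y * x%:~R)) <=
  (1 + \sum_(v <- nbhd ca) expR (- y * v%:~R)) *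
    pairing (defects ca xi D0 t) (fun x => expR (y * x%:~R)).
Proof.
move=> fD; have fDt := @defects_supported ca xi D0 t fD.
rewrite pairing_step// -pairingZ//; apply: pairing_le => // x.
rewrite mulrDl mul1r -[leLHS]add0r lerD ?expR_ge0// mulr_suml.
apply: ler_sum => v _.
rewrite -expRD mulNr -[- (y * _)]mulrN -mulrDr -[- v%:~R]rmorphN -rmorphD/= [- v + x]addrC.
by case: change; rewrite ?mul1r// mul0r expR_ge0.
Qed.

Lemma pairing_expR_steps (R : realType) ca xi D0 (y : R) (C : R) : finitely_supported D0 ->
  C = 1 + \sum_(v <- nbhd ca) expR (- y * v%:~R) -> forall t r,
  pairing (defects ca xi D0 (t + r)) (fun x => expR (y * x%:~R)) <=
  C ^+ r * pairing (defects ca xi D0 t) (fun x => expR (y * x%:~R)).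
Proof.
move=> fD CE t; have C0 : 0 <= C.
  by rewrite CE addr_ge0// sumr_ge0// => v _; rewrite expR_ge0.
elim=> [|r IH]; first by rewrite addn0 mul1r.
rewrite addnS; apply: (le_trans (@pairing_expR_step _ ca xi D0 (t + r) y fD)).
by rewrite -CE exprS -mulrA ler_wpM2l.
Qed.

Lemma initial_defects_supported D0 : initial_defects D0 -> finitely_supported D0.
Proof.
case=> _ /finite_seqP[s sE]; exists (undup s); first exact: undup_uniq.
by move=> x x0; rewrite mem_undup; have : [set x | D0 x != 0%N] x := x0; rewrite sE.
Qed.

Lemma window_defects_mass (R : realType) ca xi D0 (s : nat -> seq int) (alpha eps : R) t :
  uniq (s t) -> (forall x, defects ca xi D0 t x != 0%N -> x \in s t) ->
  window_defects ca xi D0 alpha eps t = window_mass (defects ca xi D0) s alpha eps t.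
Proof.
move=> us fs; rewrite /window_defects fsbig_mkcond/= /window_mass [RHS]big_mkcond/=.
rewrite (@fsum_seq _ (s t))// => [|x]; last first.
  rewrite patchE; case: ifP => _; last by rewrite eqxx.
  by rewrite pnatr_eq0 => /fs.
apply: eq_bigr => x _; rewrite patchE; congr (if _ then _ else _).
by apply/idP/idP => [/set_mem|h]//; apply/mem_set.
Qed.

(** * The expansion graph *)

Lemma vert_subproof (sigma : nat) (x : int) : (0 < sigma)%N ->
  (`|(x %% sigma%:Z)%Z|%N < sigma)%N.
Proof.
move=> s0; have sz : (sigma%:Z != 0) by rewrite eqz_nat -lt0n.
by rewrite -ltz_nat gez0_abs ?modz_ge0// ltz_pmod.
Qed.

Definition vert (sigma : nat) (s0 : (0 < sigma)%N) (x : int) : 'I_sigma :=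
  Ordinal (vert_subproof x s0).

Lemma vertE sigma (sigma0 : (0 < sigma)%N) x : (vert sigma0 x)%:Z = (x %% sigma%:Z)%Z.
Proof.
have sz : (sigma%:Z != 0) by rewrite eqz_nat -lt0n.
by rewrite /= gez0_abs ?modz_ge0.
Qed.

Lemma vert_mod sigma (sigma0 : (0 < sigma)%N) x y :
  (x = y %[mod sigma%:Z])%Z -> vert sigma0 x = vert sigma0 y.
Proof. by move=> xy; apply/val_inj; rewrite /= xy. Qed.

Lemma vertMDl sigma (sigma0 : (0 < sigma)%N) q x :
  vert sigma0 (q * sigma%:Z + x) = vert sigma0 x.
Proof. by apply: vert_mod; rewrite modzMDl. Qed.

Lemma vert_ord sigma (sigma0 : (0 < sigma)%N) (i : 'I_sigma) : vert sigma0 i%:Z = i.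
Proof. by apply/val_inj; rewrite /= modz_small ?ltz_nat ?ltn_ord. Qed.

Lemma vert_decomp sigma (sigma0 : (0 < sigma)%N) x :
  x = (x %/ sigma%:Z)%Z * sigma%:Z + (vert sigma0 x)%:Z.
Proof. by rewrite vertE -divz_eq. Qed.

Definition target (sigma : nat) (sigma0 : (0 < sigma)%N) (s0 : nat) (f : edge sigma) :
  'I_sigma := vert sigma0 (f.1%:Z + f.2 - s0%:Z).

Lemma terminal_vertexE sigma (sigma0 : (0 < sigma)%N) s0 (f : edge sigma) :
  terminal_vertex s0 f = (target sigma0 s0 f)%:Z.
Proof. by rewrite vertE. Qed.

Lemma terminal_vertex_eq sigma (sigma0 : (0 < sigma)%N) s0 (f : edge sigma) (j : 'I_sigma) :
  (terminal_vertex s0 f == j%:Z) = (target sigma0 s0 f == j).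
Proof. by rewrite terminal_vertexE eqz_nat. Qed.

Lemma shift_config_mod eta sigma q b : spatially_periodic eta sigma ->
  shift_config (q * sigma%:Z + b) eta = shift_config b eta.
Proof.
move=> per; apply/funext => x; rewrite /shift_config per [RHS]per; congr eta.
by rewrite opprD addrCA -mulNr modzMDl.
Qed.

Lemma trajectory_period ca eta p0 s0 n : shifted_by ca eta p0 s0 ->
  trajectory ca eta (n * p0) = shift_config (n%:Z * s0%:Z) eta.
Proof.
move=> sh; have sh' : trajectory ca eta p0 = shift_config s0%:Z eta by apply/funext.
elim: n => [|n IH].
  by apply/funext => x; rewrite /shift_config mul0r subr0.
rewrite mulSn addnC trajectoryD IH trajectory_shift sh'.
apply/funext => x; rewrite /shift_config; congr eta.
by rewrite -addn1 PoszD mulrDl mul1r opprD addrA.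
Qed.

(* [out_sum y w i] is row [i] of the weighted vertex matrix applied to [w]. *)
Definition out_sum (R : realType) ca eta sigma (sigma0 : (0 < sigma)%N) p0 s0 d
    (e : d.-tuple (edge sigma)) (y : R) (w : 'I_sigma -> R) (i : 'I_sigma) : R :=
  \sum_(k < d | initial_vertex (tnth e k) == i)
    (edge_size ca eta p0 (tnth e k))%:R * expR (y * (displacement (tnth e k))%:~R) *
    w (target sigma0 s0 (tnth e k)).

(** After [n] shift periods the state is [eta] moved by [n s0]. Modulo [sigma] this is the shift by
    [a - i], so a defect at [a] evolves as the translate of a defect at vertex [i], and the sites
    that it reaches are labelled by the edges leaving [i]. *)
Lemma pairing_period (R : realType) ca eta sigma (sigma0 : (0 < sigma)%N) p0 s0 d
    (e : d.-tuple (edge sigma)) (y : R) (w : 'I_sigma -> R) n (a : int) :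
  spatially_periodic eta sigma -> shifted_by ca eta p0 s0 -> edge_ordering ca eta p0 e ->
  pairing (defects ca (trajectory ca eta (n * p0)) (point_defect a) p0)
    (fun x => expR (y * x%:~R) * w (vert sigma0 (x - n.+1%:Z * s0%:Z))) =
  expR (y * a%:~R) *
    out_sum ca eta sigma0 p0 s0 e y w (vert sigma0 (a - n%:Z * s0%:Z)).
Proof.
move=> per sh [ue eP].
set i := vert sigma0 (a - n%:Z * s0%:Z).
have ai := vert_decomp sigma0 (a - n%:Z * s0%:Z); rewrite -/i in ai.
set q := (_ %/ _)%Z in ai.
have trE : trajectory ca eta (n * p0) = shift_config (a - i%:Z) eta.
  rewrite (trajectory_period n sh) -(shift_config_mod q (n%:Z * s0%:Z) per).
  by congr (shift_config _ eta); lia.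
have dE x : defects ca (trajectory ca eta (n * p0)) (point_defect a) p0 x =
    edge_size ca eta p0 (i, x - a).
  have -> : point_defect a = fun x => point_defect i%:Z (x - (a - i%:Z)).
    by apply/funext => z; rewrite /point_defect; congr (nat_of_bool _); lia.
  by rewrite trE defects_shift /edge_size /=; congr defects; lia.
pose s := [seq a + f.2 | f <- e & f.1 == i].
have us : uniq s.
  rewrite map_inj_in_uniq ?filter_uniq// => -[f1 f2] [g1 g2].
  by rewrite !mem_filter /= => /andP[/eqP-> _] /andP[/eqP-> _] /addrI ->.
have fs x : defects ca (trajectory ca eta (n * p0)) (point_defect a) p0 x != 0%N -> x \in s.
  rewrite dE -lt0n -eP => ex; apply/mapP; exists (i, x - a); first by rewrite mem_filter /= eqxx.
  by rewrite /= addrC subrK.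
rewrite (pairingE _ us fs) /s big_map big_filter big_tuple mulr_sumr.
apply: eq_bigr => k /eqP ki; set f := tnth e k in ki *.
have -> : defects ca (trajectory ca eta (n * p0)) (point_defect a) p0 (a + f.2) =
    edge_size ca eta p0 f.
  by rewrite dE [a + _]addrC addrK -ki; case: (f).
have -> : vert sigma0 (a + f.2 - n.+1%:Z * s0%:Z) = target sigma0 s0 f.
  rewrite /target ki -[RHS](vertMDl sigma0 q); congr vert.
  rewrite -addn1 PoszD mulrDl mul1r.
  move: ai; move: (q * _) (n%:Z * _) => u1 u2 ai.
  by lia.
by rewrite rmorphD/= mulrDr expRD /displacement; ring.
Qed.

Lemma pairing_vertex_step (R : realType) ca eta sigma (sigma0 : (0 < sigma)%N) p0 s0 d
    (e : d.-tuple (edge sigma)) (y : R) (w : 'I_sigma -> R) n D0 :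
  spatially_periodic eta sigma -> shifted_by ca eta p0 s0 -> edge_ordering ca eta p0 e ->
  finitely_supported D0 ->
  pairing (defects ca eta D0 (n.+1 * p0))
    (fun x => expR (y * x%:~R) * w (vert sigma0 (x - n.+1%:Z * s0%:Z))) =
  pairing (defects ca eta D0 (n * p0))
    (fun x => expR (y * x%:~R) *
       out_sum ca eta sigma0 p0 s0 e y w (vert sigma0 (x - n%:Z * s0%:Z))).
Proof.
move=> per sh eP fD; rewrite mulSn addnC defectsD pairing_superposition; last first.
  exact: defects_supported.
by congr pairing; apply/funext => a; exact: pairing_period.
Qed.

Lemma pairing_vertex_pow (R : realType) ca eta sigma (sigma0 : (0 < sigma)%N) p0 s0 d
    (e : d.-tuple (edge sigma)) (y : R) (w : 'I_sigma -> R) n D0 :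
  spatially_periodic eta sigma -> shifted_by ca eta p0 s0 -> edge_ordering ca eta p0 e ->
  finitely_supported D0 ->
  pairing (defects ca eta D0 (n * p0))
    (fun x => expR (y * x%:~R) * w (vert sigma0 (x - n%:Z * s0%:Z))) =
  pairing D0 (fun x => expR (y * x%:~R) *
    iter n (out_sum ca eta sigma0 p0 s0 e y) w (vert sigma0 x)).
Proof.
move=> per sh eP fD; elim: n w => [|n IH] w.
  by congr pairing; apply/funext => x; rewrite mul0r subr0.
by rewrite (pairing_vertex_step sigma0 y w n per sh eP fD) IH iterSr.
Qed.

(** * Powers and irreducibility of the vertex and edge matrices *)

Lemma edge_mxE (R : realType) ca eta sigma (sigma0 : (0 < sigma)%N) p0 s0 d
    (e : d.-tuple (edge sigma)) k l :
  edge_mx ca eta p0 s0 R e k l =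
  (edge_size ca eta p0 (tnth e k))%:R *
    (target sigma0 s0 (tnth e k) == initial_vertex (tnth e l))%:R.
Proof.
by rewrite mxE (terminal_vertex_eq sigma0); case: eqP; rewrite ?mulr1 ?mulr0.
Qed.

Lemma vertex_mulmxE (R : realType) ca eta sigma (sigma0 : (0 < sigma)%N) p0 s0 d
    (e : d.-tuple (edge sigma)) n (X : 'M[R]_(sigma, n)) i j :
  (vertex_mx ca eta p0 s0 R e *m X) i j =
  \sum_(k < d | initial_vertex (tnth e k) == i)
    (edge_size ca eta p0 (tnth e k))%:R * X (target sigma0 s0 (tnth e k)) j.
Proof.
rewrite mxE; under eq_bigr do rewrite mxE mulr_suml.
rewrite (exchange_big_dep (fun k => initial_vertex (tnth e k) == i)) /=.
  apply: eq_bigr => k ki; rewrite (big_pred1 (target sigma0 s0 (tnth e k)))// => b.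
  by rewrite ki (terminal_vertex_eq sigma0) eq_sym.
by move=> b k _ /andP[].
Qed.

(** If [X] sends an edge to its terminal vertex with its size and [Y] a vertex to its outgoing
    edges, then [T = X Y] and [T' = Y X], so that [T^(n+1) = X T'^n Y]; hence the shift of the
    exponent. *)
Lemma edge_mx_expS (R : realType) ca eta sigma (sigma0 : (0 < sigma)%N) p0 s0 d
    (e : d.-tuple (edge sigma)) n k l :
  (edge_mx ca eta p0 s0 R e ^+ n.+1) k l =
  (edge_size ca eta p0 (tnth e k))%:R *
    (vertex_mx ca eta p0 s0 R e ^+ n) (target sigma0 s0 (tnth e k)) (initial_vertex (tnth e l)).
Proof.
elim: n k => [|n IH] k; first by rewrite expr1 expr0 [X in _ * X]mxE (edge_mxE _ _ _ sigma0).
rewrite exprS -mulmxE mxE [in RHS]exprS -mulmxE (vertex_mulmxE _ _ sigma0) mulr_sumr.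
rewrite [RHS]big_mkcond; apply: eq_bigr => j _; rewrite (edge_mxE _ _ _ sigma0) IH eq_sym.
by case: eqP => _; rewrite ?mulr1 ?mulr0 ?mul0r.
Qed.

Lemma vertex_mx_ge0 (R : realType) ca eta sigma p0 s0 d (e : d.-tuple (edge sigma)) i j :
  0 <= vertex_mx ca eta p0 s0 R e i j.
Proof. by rewrite mxE sumr_ge0. Qed.

Lemma edge_mx_ge0 (R : realType) ca eta sigma p0 s0 d (e : d.-tuple (edge sigma)) i j :
  0 <= edge_mx ca eta p0 s0 R e i j.
Proof. by rewrite mxE; case: ifP. Qed.

Lemma vertex_expE (R : realType) ca eta sigma (sigma0 : (0 < sigma)%N) p0 s0 d
    (e : d.-tuple (edge sigma)) n (w : 'cV[R]_sigma) i :
  (vertex_mx ca eta p0 s0 R e ^+ n *m w) i 0 =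
  iter n (out_sum ca eta sigma0 p0 s0 e 0) (fun j => w j 0) i.
Proof.
elim: n i => [|n IH] i; first by rewrite expr0 mul1mx.
rewrite exprS -mulmxE -mulmxA (vertex_mulmxE _ _ sigma0) iterS; apply: eq_bigr => k _.
by rewrite IH mul0r expR0 mulr1.
Qed.

(** At [y = 0], pairing with the indicator of vertex [b] in the moving frame counts the defects in
    that class. The count equals the matrix entry and is at least the number of defects at [x]. *)
Lemma vertex_exp_gt0 (R : realType) ca eta sigma (sigma0 : (0 < sigma)%N) p0 s0 d
    (e : d.-tuple (edge sigma)) n (i : 'I_sigma) x :
  spatially_periodic eta sigma -> shifted_by ca eta p0 s0 -> edge_ordering ca eta p0 e ->
  (0 < defects ca eta (point_defect i%:Z) (n * p0) x)%N ->
  0 < (vertex_mx ca eta p0 s0 R e ^+ n) i (vert sigma0 (x - n%:Z * s0%:Z)).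
Proof.
move=> per sh eP dx; set b := vert _ _.
have fi := point_defect_supported i%:Z.
have := pairing_vertex_pow sigma0 0 (fun j => (delta_mx b 0 : 'cV[R]_sigma) j 0) n per sh eP fi.
rewrite pairing_point mul0r expR0 mul1r vert_ord -vertex_expE -colE mxE => <-.
have fd := @defects_supported ca eta _ (n * p0) fi.
apply: lt_le_trans (pairing_ge_term x fd _); last first.
  by move=> z; rewrite mulr_ge0 ?expR_ge0// mxE ler0n.
by rewrite mulr_gt0 ?ltr0n// mul0r expR0 mul1r mxE /b !eqxx ltr01.
Qed.

(** The remainder of [p] modulo [p0] is a time at which [eta] is translated, so minimality of [p0]
    makes it 0; the residue of the total shift [q s0] is a spatial period, so minimality of [sigma]
    makes it 0. Hence time [p] corresponds to a power of the vertex matrix, without rotation of the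
    vertices. *)
Lemma temporal_period_multiple ca eta sigma p p0 s0 :
  doubly_periodic ca eta sigma p p0 s0 ->
  exists2 q, (0 < q)%N & p = (q * p0)%N /\ (sigma%:Z %| q%:Z * s0%:Z)%Z.
Proof.
move=> [[sigma0 per minper] [p_gt0 pper _] [p0_gt0 _ minp0] s0_lt sh].
set q := (p %/ p0)%N; set r := (p %% p0)%N.
have pE : p = (q * p0 + r)%N by exact: divn_eq.
have trp : trajectory ca eta p = eta by apply/funext.
have trr : trajectory ca eta r = shift_config (- (q%:Z * s0%:Z)) eta.
  have : shift_config (q%:Z * s0%:Z) (trajectory ca eta r) = eta.
    by rewrite -[RHS]trp pE trajectoryD (trajectory_period _ sh) trajectory_shift.
  move=> h; apply/funext => x; rewrite -[in RHS]h /shift_config; congr (trajectory _ _ _ _).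
  by lia.
have r0 : r = 0%N.
  apply/eqP; rewrite -leqn0 leqNgt; apply/negP => r_gt0.
  have rlt : (r < p0)%N by rewrite ltn_mod.
  suff : (p0 <= r)%N by rewrite leqNgt rlt.
  apply: minp0 => //.
  exists (val (vert sigma0 (- (q%:Z * s0%:Z)))); first exact: ltn_ord.
  move=> x; rewrite trr.
  have := vert_decomp sigma0 (- (q%:Z * s0%:Z)).
  set k := (_ %/ _)%Z => kE; rewrite {1}kE.
  by rewrite (shift_config_mod _ _ per).
have q0 : (0 < q)%N by move: p_gt0; rewrite pE r0 addn0 muln_gt0 => /andP[].
exists q => //; split; first by rewrite pE r0 addn0.
have qs : shift_config (q%:Z * s0%:Z) eta = eta.
  by rewrite -(trajectory_period q sh) -[in RHS]trp pE r0 addn0.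
set m := vert sigma0 (q%:Z * s0%:Z).
have mE := vert_decomp sigma0 (q%:Z * s0%:Z); rewrite -/m in mE.
have ms : shift_config m%:Z eta = eta.
  by rewrite -[RHS]qs [in RHS]mE shift_config_mod.
have [m0|m_gt0] := posnP m.
  by rewrite mE m0 addr0 dvdz_mull.
suff : (sigma <= m)%N by rewrite leqNgt ltn_ord.
apply: minper => // x.
have iterm (k : nat) y : eta (y + k%:Z * m%:Z) = eta y.
  elim: k => [|k IH]; first by rewrite mul0r addr0.
  rewrite -IH -[in LHS]ms /shift_config; congr eta.
  by rewrite -addn1 PoszD mulrDl mul1r addrA addrK.
rewrite [in LHS](divz_eq x m%:Z) addrC; case: (x %/ m%:Z)%Z => k; first exact: iterm.
by rewrite NegzE mulNr -(iterm k.+1) subrK.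
Qed.

Lemma vertex_irreducible (R : realType) ca eta sigma (sigma0 : (0 < sigma)%N) p p0 s0 d
    (e : d.-tuple (edge sigma)) :
  doubly_periodic ca eta sigma p p0 s0 -> irreducible_config ca eta sigma p ->
  edge_ordering ca eta p0 e -> irreducible_mx (vertex_mx ca eta p0 s0 R e).
Proof.
move=> heta irr eP; have [q q0 [pE qs]] := temporal_period_multiple heta.
have [[_ per _] _ _ _ sh] := heta.
set T' := vertex_mx _ _ _ _ _ _.
(* Since [sigma] divides [q s0], the moving frame is back in place after [q] shift periods, and a
   defect in class [b] witnesses a positive entry. *)
have step i b : 0 < reduced_kernel ca eta sigma p i b -> 0 < (T' ^+ q) i b.
  rewrite mxE; case: asboolP => // -[x xb dx] _.
  rewrite pE in dx; have := vertex_exp_gt0 R sigma0 per sh eP dx.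
  have -> : vert sigma0 (x - q%:Z * s0%:Z) = b => [|//].
  rewrite -[RHS](vert_ord sigma0); apply: vert_mod; rewrite -xb.
  by have /dvdzP[z ->] := qs; rewrite -mulNr addrC modzMDl.
have K0 i j : 0 <= reduced_kernel ca eta sigma p i j by rewrite mxE.
have pow m i b : 0 < (reduced_kernel ca eta sigma p ^+ m) i b -> 0 < (T' ^+ (m * q)) i b.
  elim: m i => [|m IH] i; first by rewrite mul0n !expr0 !mxE !ltr0n.
  rewrite exprS -mulmxE mxE => /gt_eqF/negbT.
  rewrite psumr_neq0 => [/hasP[c _ /= h]|c _]; last by rewrite mulr_ge0// exprmx_ge0.
  have [h1 h2] : 0 < reduced_kernel ca eta sigma p i c /\
                 0 < (reduced_kernel ca eta sigma p ^+ m) c b.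
    have := h; rewrite !lt_def K0 exprmx_ge0// !andbT mulf_eq0 negb_or.
    by move=> /andP[/andP[-> ->] _].
  rewrite mulSn exprD -mulmxE mxE (bigD1 c)//= ltr_pwDl ?mulr_gt0 ?step ?IH//.
  apply: sumr_ge0 => z _.
  by rewrite mulr_ge0 ?exprmx_ge0// => *; exact: vertex_mx_ge0.
move=> i j; have [m m0 Km] := irr i j.
by exists (m * q)%N; [rewrite muln_gt0 m0|exact: pow].
Qed.

Lemma irreducible_pattern (F G : numDomainType) n (A : 'M[F]_n) (B : 'M[G]_n) :
  (forall i j, 0 <= A i j) -> (forall i j, 0 <= B i j) ->
  (forall i j, 0 < A i j -> 0 < B i j) -> irreducible_mx A -> irreducible_mx B.
Proof.
move=> A0 B0 AB irr.
have pow m i b : 0 < (A ^+ m) i b -> 0 < (B ^+ m) i b.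
  elim: m i => [|m IH] i; first by rewrite !expr0 !mxE !ltr0n.
  rewrite exprS -mulmxE mxE => /gt_eqF/negbT.
  rewrite psumr_neq0 => [/hasP[c _ /= h]|c _]; last by rewrite mulr_ge0// exprmx_ge0.
  have [h1 h2] : 0 < A i c /\ 0 < (A ^+ m) c b.
    have := h; rewrite !lt_def A0 exprmx_ge0// !andbT mulf_eq0 negb_or.
    by move=> /andP[/andP[-> ->] _].
  rewrite exprS -mulmxE mxE (bigD1 c)//= ltr_pwDl ?mulr_gt0 ?AB ?IH//.
  by apply: sumr_ge0 => z _; rewrite mulr_ge0 ?exprmx_ge0.
by move=> i j; have [m m0 Am] := irr i j; exists m => //; exact: pow.
Qed.

Lemma edge_irreducible (R : realType) ca eta sigma (sigma0 : (0 < sigma)%N) p0 s0 d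
    (e : d.-tuple (edge sigma)) :
  edge_ordering ca eta p0 e ->
  irreducible_mx (vertex_mx ca eta p0 s0 R e) -> irreducible_mx (edge_mx ca eta p0 s0 R e).
Proof.
move=> [_ eP] irr k l.
have [m m0 Tm] := irr (target sigma0 s0 (tnth e k)) (initial_vertex (tnth e l)).
exists m.+1 => //; rewrite (edge_mx_expS _ _ _ sigma0) mulr_gt0// ltr0n -eP.
exact: mem_tnth.
Qed.

(** A vertex without outgoing edges gives a zero row in every positive power; the positivity of the
    exponent in [irreducible_mx] enters here. *)
Lemma exists_out_edge (R : realType) ca eta sigma p0 s0 d (e : d.-tuple (edge sigma)) i :
  irreducible_mx (vertex_mx ca eta p0 s0 R e) ->
  exists k, initial_vertex (tnth e k) = i.
Proof.
move=> /(_ i i)[[//|m] _]; rewrite exprS -mulmxE mxE => /gt_eqF/negbT.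
apply: contraPP => /forallNP h; apply/negP; rewrite negbK.
rewrite big1// => j _; rewrite mxE big_pred0 ?mul0r// => k.
by apply/negP => /andP[/eqP/h].
Qed.

(** * Weighted edge matrices and exponential moments *)

Lemma weighted_mxE (R : realType) n (A : 'M[R]_n) (v : 'rV[R]_n) i j :
  (A *m diag_mx v) i j = A i j * v 0 j.
Proof. by rewrite mul_mx_diag mxE. Qed.

Lemma weighted_edge_mxE (R : realType) ca eta sigma p0 s0 d (e : d.-tuple (edge sigma))
    (y : R) k l :
  (edge_mx ca eta p0 s0 R e *m weight_mx e y) k l =
  edge_mx ca eta p0 s0 R e k l * expR (y * (displacement (tnth e l))%:~R).
Proof. by rewrite weighted_mxE [X in _ * X]mxE. Qed.

Lemma weighted_edge_ge0 (R : realType) ca eta sigma p0 s0 d (e : d.-tuple (edge sigma))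
    (y : R) k l : 0 <= (edge_mx ca eta p0 s0 R e *m weight_mx e y) k l.
Proof. by rewrite weighted_edge_mxE mulr_ge0 ?expR_ge0 ?edge_mx_ge0. Qed.

Lemma weighted_edge_irreducible (R : realType) ca eta sigma p0 s0 d
    (e : d.-tuple (edge sigma)) (y : R) :
  irreducible_mx (edge_mx ca eta p0 s0 R e) ->
  irreducible_mx (edge_mx ca eta p0 s0 R e *m weight_mx e y).
Proof.
apply: irreducible_pattern => [i j|i j|i j]; first exact: edge_mx_ge0.
  exact: weighted_edge_ge0.
by rewrite weighted_edge_mxE => T0; rewrite mulr_gt0 ?expR_gt0.
Qed.

(* The weighted edge matrix is a product [X Y] through the vertices, and [out_sum]
   acts as [Y X]; so [Y] maps eigenvectors of the former to those of the latter. *)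
Lemma vertex_eigen (R : realType) ca eta sigma (sigma0 : (0 < sigma)%N) p0 s0 d
    (e : d.-tuple (edge sigma)) (y rho : R) (r : 'cV[R]_d) :
  edge_mx ca eta p0 s0 R e *m weight_mx e y *m r = rho *: r ->
  let v i := \sum_(k < d | initial_vertex (tnth e k) == i)
    expR (y * (displacement (tnth e k))%:~R) * r k 0 in
  forall i, out_sum ca eta sigma0 p0 s0 e y v i = rho * v i.
Proof.
move=> Tr v i; rewrite /out_sum /v mulr_sumr; apply: eq_bigr => k _.
have -> : rho * (expR (y * (displacement (tnth e k))%:~R) * r k 0) =
    expR (y * (displacement (tnth e k))%:~R) * (rho *: r) k 0 by rewrite mxE mulrCA.
rewrite -Tr mxE mulrAC [RHS]mulrC; congr (_ * _).
rewrite mulr_sumr big_mkcond; apply: eq_bigr => l _.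
rewrite weighted_edge_mxE (edge_mxE _ _ _ sigma0) eq_sym.
by case: eqP => _; rewrite ?mulr0 ?mulr1 ?mul0r// mulrA.
Qed.

Lemma iter_out_sum (R : realType) ca eta sigma (sigma0 : (0 < sigma)%N) p0 s0 d
    (e : d.-tuple (edge sigma)) (y rho : R) v n i :
  (forall i, out_sum ca eta sigma0 p0 s0 e y v i = rho * v i) ->
  iter n (out_sum ca eta sigma0 p0 s0 e y) v i = rho ^+ n * v i.
Proof.
move=> ev; elim: n i => [|n IH] i; first by rewrite mul1r.
rewrite iterS exprSr -mulrA -ev /out_sum mulr_sumr; apply: eq_bigr => k _.
by rewrite IH mulrCA.
Qed.

Lemma defects_period_bounds (R : realType) ca eta sigma p p0 s0 d
    (e : d.-tuple (edge sigma)) D0 (y rho : R) (r : 'cV[R]_d) :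
  doubly_periodic ca eta sigma p p0 s0 -> edge_ordering ca eta p0 e ->
  (forall i, exists k, initial_vertex (tnth e k) = i) -> initial_defects D0 ->
  (forall k, 0 < r k 0) -> 0 < rho ->
  edge_mx ca eta p0 s0 R e *m weight_mx e y *m r = rho *: r ->
  exists a b : R, [/\ 0 < a, 0 < b & forall n,
    a * rho ^+ n <= pairing (defects ca eta D0 (n * p0)) (fun x => expR (y * x%:~R))
      <= b * rho ^+ n].
Proof.
move=> heta eP out iD r0 rho0 Tr.
have [[sigma0 per _] _ _ _ sh] := heta.
have fD := initial_defects_supported iD.
pose v i := \sum_(k < d | initial_vertex (tnth e k) == i)
    expR (y * (displacement (tnth e k))%:~R) * r k 0.
have ev i : out_sum ca eta sigma0 p0 s0 e y v i = rho * v i by exact: vertex_eigen.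
have v0 i : 0 < v i.
  have [k ki] := out i; rewrite /v (bigD1 k) ?ki//= ltr_pwDl//.
    by rewrite mulr_gt0 ?expR_gt0.
  by apply: sumr_ge0 => l _; rewrite mulr_ge0 ?expR_ge0// ltW.
(* The eigenvector weight lies between two positive constants, so the exact value [rho ^+ n * H] of
   the weighted sum controls the unweighted one. *)
pose vm := \big[Num.min/1]_i v i; pose vM := 1 + \sum_i v i.
have vm0 : 0 < vm by apply: lt_bigmin.
have vmv i : vm <= v i by exact: bigmin_le.
have vM0 : 0 < vM by rewrite ltr_wpDr// sumr_ge0// => i _; exact: ltW.
have vvM i : v i <= vM.
  rewrite /vM (bigD1 i)//= addrCA lerDl addr_ge0// sumr_ge0// => j _; exact: ltW.
pose H := pairing D0 (fun x => expR (y * x%:~R) * v (vert sigma0 x)).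
have H0 : 0 < H.
  have [[x Dx] _] := iD.
  apply: lt_le_trans (pairing_ge_term x fD _) => [|z].
    by rewrite !mulr_gt0 ?expR_gt0// ltr0n lt0n.
  by rewrite mulr_ge0 ?expR_ge0// ltW.
have HE n : pairing (defects ca eta D0 (n * p0))
    (fun x => expR (y * x%:~R) * v (vert sigma0 (x - n%:Z * s0%:Z))) = rho ^+ n * H.
  rewrite (pairing_vertex_pow sigma0 y v n per sh eP fD) -pairingZ//.
  by congr pairing; apply/funext => x; rewrite (iter_out_sum _ _ ev) mulrCA.
exists (H / vM), (H / vm); split; [by rewrite divr_gt0|by rewrite divr_gt0|].
move=> n; have fDn := @defects_supported ca eta D0 (n * p0) fD.
apply/andP; split.
  rewrite mulrAC ler_pdivrMr// [H * _]mulrC -HE [leRHS]mulrC -pairingZ//.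
  by apply: pairing_le => // x; rewrite mulrC ler_wpM2r ?expR_ge0.
rewrite mulrAC ler_pdivlMr// [H * _]mulrC -HE [leLHS]mulrC -pairingZ//.
by apply: pairing_le => // x; rewrite mulrC ler_wpM2l ?expR_ge0.
Qed.

Lemma expR_subperiod_le (R : realType) (L : R) (p0 t u : nat) :
  (t <= u + p0)%N -> (u <= t + p0)%N ->
  expR (t%:R * L) <= expR (p0%:R * `|L|) * expR (u%:R * L).
Proof.
move=> tu ut; rewrite -expRD ler_expR -lerBlDr -mulrBl.
apply: (le_trans (ler_norm _)); rewrite normrM ler_wpM2r//.
rewrite ler_norml lerNl opprB lerBlDr lerBlDr -!natrD !ler_nat.
by rewrite addnC ut addnC tu.
Qed.

Lemma defects_mgf_growth (R : realType) ca eta sigma p p0 s0 d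
    (e : d.-tuple (edge sigma)) D0 (s : nat -> seq int) :
  doubly_periodic ca eta sigma p p0 s0 -> edge_ordering ca eta p0 e ->
  irreducible_mx (vertex_mx ca eta p0 s0 R e) -> initial_defects D0 ->
  (forall t, uniq (s t)) -> (forall t x, defects ca eta D0 t x != 0%N -> x \in s t) ->
  mgf_growth (defects ca eta D0) s
    (fun y : R => p0%:R^-1 * ln (spr (edge_mx ca eta p0 s0 R e *m weight_mx e y))).
Proof.
move=> heta eP irrV iD us fs y.
have [[sigma0 per _] _ [p0_gt0 _ _] _ sh] := heta.
have fD := initial_defects_supported iD.
have out i : exists k, initial_vertex (tnth e k) = i by exact: exists_out_edge irrV.
have d0 : (0 < d)%N by have [[k kd] _] := out (Ordinal sigma0); exact: leq_trans kd.
set A := edge_mx _ _ _ _ _ _ *m _.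
have irrA : irreducible_mx A by apply/weighted_edge_irreducible/edge_irreducible.
have [rho0 [u [r [_ r0 _ Ar _]]]] :=
  perron_frobenius d0 (@weighted_edge_ge0 R ca eta _ p0 s0 d e y) irrA.
rewrite -/A in rho0 Ar.
have [a [b [a0 b0 ab]]] := defects_period_bounds heta eP out iD r0 rho0 Ar.
set L := p0%:R^-1 * _.
have rhoE n : spr A ^+ n = expR ((n * p0)%:R * L).
  rewrite natrM /L mulrA mulfK ?pnatr_eq0 -?lt0n// expRM_natl lnK//.
have [C C1 steps] : exists2 C : R, 1 <= C & forall t r,
    pairing (defects ca eta D0 (t + r)) (fun x => expR (y * x%:~R)) <=
    C ^+ r * pairing (defects ca eta D0 t) (fun x => expR (y * x%:~R)).
  exists (1 + \sum_(v <- nbhd ca) expR (- y * v%:~R)); last exact: pairing_expR_steps.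
  by rewrite lerDl sumr_ge0// => v _; exact: expR_ge0.
have C0 : 0 < C by apply: lt_le_trans C1.
(* The first factor pays for at most [p0] steps of the dynamics, the second for moving the exponent
   by at most [p0] time units. *)
pose Q := C ^+ p0 * expR (p0%:R * `|L|).
have Q0 : 0 < Q by rewrite mulr_gt0 ?exprn_gt0 ?expR_gt0.
have Pge0 t : 0 <= pairing (defects ca eta D0 t) (fun x => expR (y * x%:~R)).
  have fDt := @defects_supported ca eta D0 t fD.
  apply: le_trans (pairing_ge_term 0 fDt _) => [|x]; last exact: expR_ge0.
  by rewrite mulr_ge0 ?expR_ge0.
exists (a / Q), (b * Q); split; first by rewrite divr_gt0.
move=> t; rewrite /mgf -(pairingE _ (us t) (fs t)).
set n := (t %/ p0)%N; have rlt : (t %% p0 < p0)%N by rewrite ltn_mod.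
have tE : t = (n * p0 + t %% p0)%N by exact: divn_eq.
(* The growth of a step is bounded only from above, so the lower bound at [t] looks ahead to the
   multiple [n.+1 * p0] and the upper bound looks back to [n * p0]. *)
apply/andP; split.
  have tn : (n.+1 * p0)%N = (t + (p0 - t %% p0))%N.
    have -> : (t + (p0 - t %% p0) = n * p0 + (t %% p0 + (p0 - t %% p0)))%N.
      by rewrite addnA -tE.
    by rewrite mulSn subnKC ?(ltnW rlt)// addnC.
  have /andP[lo _] := ab n.+1.
  rewrite mulrAC ler_pdivrMr//.
  apply: (@le_trans _ _ (a * (expR (p0%:R * `|L|) * expR ((n.+1 * p0)%:R * L)))).
    apply: ler_wpM2l; first exact: ltW.
    apply: expR_subperiod_le; rewrite tn; last by rewrite leq_add2l leq_subr.
    by rewrite -addnA leq_addr.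
  rewrite -rhoE mulrCA /Q [leRHS]mulrA [leRHS]mulrC ler_wpM2l ?expR_ge0//.
  apply: (le_trans lo); rewrite tn; apply: (le_trans (steps _ _)).
  by rewrite mulrC ler_wpM2l// ler_weXn2l// leq_subr.
have /andP[_ hi] := ab n.
rewrite {1}tE; apply: (le_trans (steps _ _)).
apply: (@le_trans _ _ (C ^+ p0 * (b * expR ((n * p0)%:R * L)))).
  by rewrite -rhoE ler_pM// ?exprn_ge0 ?(ltW C0)// ler_weXn2l// ltnW.
rewrite /Q mulrCA -[leRHS]mulrA ler_wpM2l ?(ltW b0)// -[leRHS]mulrA ler_wpM2l ?exprn_ge0 ?(ltW C0)//.
apply: expR_subperiod_le; rewrite tE; last by rewrite leq_add2l ltnW.
by rewrite -addnA leq_addr.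
Qed.

Lemma is_derive_weighted_edge (R : realType) ca eta sigma p0 s0 d
    (e : d.-tuple (edge sigma)) (y : R) k l :
  is_derive y 1 (fun y => (edge_mx ca eta p0 s0 R e *m weight_mx e y) k l)
    ((edge_mx ca eta p0 s0 R e *m weight_mx e y) k l * (displacement (tnth e l))%:~R).
Proof.
under eq_fun do rewrite weighted_edge_mxE.
set T := edge_mx ca eta p0 s0 R e k l; set D := (displacement (tnth e l))%:~R.
have dD : is_derive y 1 (fun y : R => y * D) D.
  apply: is_derive_eq; have scaleE (a b : R) : a *: b = a * b by [].
  by rewrite !scaleE; ring.
have dE : is_derive y 1 (fun y : R => expR (y * D)) (expR (y * D) * D).
  exact: (@is_derive1_comp _ expR (fun y => y * D)).
apply: is_derive_eq; have scaleE (a b : R) : a *: b = a * b by [].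
by rewrite weighted_edge_mxE !scaleE -/T -/D; ring.
Qed.

(** Differentiating the weights multiplies column [l] by the displacement of edge [l]; applying the
    left eigenvector then produces a factor [spr], which cancels against the derivative of [ln]. *)
Lemma is_derive_log_spr (R : realType) ca eta sigma p0 s0 d
    (e : d.-tuple (edge sigma)) (y : R) (u : 'rV[R]_d) (v : 'cV[R]_d) :
  (0 < d)%N -> irreducible_mx (edge_mx ca eta p0 s0 R e) ->
  perron_pair (edge_mx ca eta p0 s0 R e *m weight_mx e y) u v ->
  is_derive y 1
    (fun y => p0%:R^-1 * ln (spr (edge_mx ca eta p0 s0 R e *m weight_mx e y)))
    (p0%:R^-1 * \sum_(l < d) v l 0 * u 0 l * (displacement (tnth e l))%:~R).
Proof.
move=> d0 irrT uvP.
pose A y := edge_mx ca eta p0 s0 R e *m weight_mx e y.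
have A0 z i j : 0 <= A z i j by exact: weighted_edge_ge0.
have irrA z : irreducible_mx (A z) by exact: weighted_edge_irreducible.
have [s_gt0 _] := perron_frobenius d0 (A0 y) (irrA y).
pose dA : 'M[R]_d := \matrix_(k, l) (A y k l * (displacement (tnth e l))%:~R).
have dAP i j : is_derive y 1 (fun y => A y i j) (dA i j).
  by rewrite mxE; exact: is_derive_weighted_edge.
have dspr := is_derive_spr d0 A0 irrA uvP dAP.
have dln := is_derive1_comp (is_derive1_ln s_gt0) dspr.
have [_ _ uA _ _] := uvP.
have E : (u *m dA *m v) 0 0 =
    spr (A y) * \sum_(l < d) v l 0 * u 0 l * (displacement (tnth e l))%:~R.
  rewrite mxE mulr_sumr; apply: eq_bigr => l _; rewrite mxE.
  have -> : \sum_j u 0 j * dA j l = (spr (A y) * u 0 l) * (displacement (tnth e l))%:~R.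
    have -> : spr (A y) * u 0 l = (spr (A y) *: u) 0 l by rewrite mxE.
    by rewrite -uA mxE mulr_suml; apply: eq_bigr => j _; rewrite mxE mulrA.
  by ring.
rewrite E mulKf ?gt_eqF// in dln.
have -> : (fun y => p0%:R^-1 * ln (spr (edge_mx ca eta p0 s0 R e *m weight_mx e y))) =
    p0%:R^-1 *: (@ln R \o (fun y => spr (A y))) by [].
by apply: is_derive_eq.
Qed.

Lemma weighted_edge0 (R : realType) ca eta sigma p0 s0 d (e : d.-tuple (edge sigma)) :
  edge_mx ca eta p0 s0 R e *m weight_mx e 0 = edge_mx ca eta p0 s0 R e.
Proof. by apply/matrixP => i j; rewrite weighted_edge_mxE mul0r expR0 mulr1. Qed.

(** At [y = 0], summing the Perron vector of the edge matrix over outgoing edges gives an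
    eigenvector of the vertex matrix; it is positive since every vertex has an outgoing edge. *)
Lemma spr_vertex_mx (R : realType) ca eta sigma (sigma0 : (0 < sigma)%N) p0 s0 d
    (e : d.-tuple (edge sigma)) :
  (forall i, exists k, initial_vertex (tnth e k) = i) ->
  irreducible_mx (edge_mx ca eta p0 s0 R e) ->
  spr (vertex_mx ca eta p0 s0 R e) = spr (edge_mx ca eta p0 s0 R e).
Proof.
move=> out irrT; set T := edge_mx _ _ _ _ _ _.
have d0 : (0 < d)%N by have [[k kd] _] := out (Ordinal sigma0); exact: leq_trans kd.
have [_ [u [r [_ r0 _ Tr _]]]] := perron_frobenius d0 (@edge_mx_ge0 R ca eta _ p0 s0 d e) irrT.
have Tr0 : T *m weight_mx e 0 *m r = spr T *: r by rewrite weighted_edge0.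
pose v : 'cV[R]_sigma := \col_i \sum_(k < d | initial_vertex (tnth e k) == i)
  expR (0 * (displacement (tnth e k))%:~R) * r k 0.
apply: (@spr_perron _ _ _ _ v) => //; first exact: vertex_mx_ge0.
  move=> i; rewrite mxE; have [k ki] := out i.
  rewrite (bigD1 k) ?ki//= ltr_pwDl//; first by rewrite mulr_gt0 ?expR_gt0.
  by apply: sumr_ge0 => l _; rewrite mulr_ge0 ?expR_ge0// ltW.
apply/colP => i; rewrite (vertex_mulmxE _ _ sigma0) [RHS]mxE.
rewrite [X in _ * X]mxE -(vertex_eigen sigma0 Tr0) /out_sum; apply: eq_bigr => k _.
by rewrite mul0r expR0 mulr1 mxE.
Qed.

(** * The Lyapunov profile *)

Unset Implicit Arguments.

(** One step of [T] spans [p0] units of time and [L] is a rate per unit, whence the factors [p0^-1].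
    The constants [c] enter as a hypothesis because a periodic [T] has none: each diagonal entry of
    [T ^+ n] vanishes for infinitely many [n] and is positive for infinitely many others. The last
    clause supplies them for primitive [T]. *)
Theorem theorem6p2 (R : realType) (ca : cellular_automaton) (eta : config)
    (sigma p p0 s0 : nat)
    (heta : doubly_periodic ca eta sigma p p0 s0)
    (hirr : irreducible_config ca eta sigma p)
    (d : nat) (e : d.-tuple (edge sigma))
    (he : edge_ordering ca eta p0 e) :
  let T : 'M[R]_d := edge_mx ca eta p0 s0 R e in
  let W : R -> 'M[R]_d := weight_mx e in
  let T' : 'M[R]_sigma := vertex_mx ca eta p0 s0 R e in
  let Lambda : R -> R := fun y => p0%:R^-1 * ln (spr (T *m W y)) in
  exists L : R -> \bar R,
    (forall D0 : int -> nat, initial_defects D0 ->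
       proper_profile R ca eta D0 /\
       forall alpha, lyapunov_profile ca eta D0 alpha = L alpha) /\
    (forall alpha, L alpha = legendre Lambda alpha) /\
    eigenvalue T (spr T) /\
    (exists lambda : R,
       is_maximum L lambda%:E /\
       lambda = p0%:R^-1 * ln (spr T') /\
       lambda = p0%:R^-1 * ln (spr T)) /\
    (exists! alpha, maximizer L alpha) /\
    (forall c : 'I_d -> R, diag_constants T c ->
       maximizer L (p0%:R^-1 * \sum_(k < d) c k * (displacement (tnth e k))%:~R)) /\
    (primitive_mx T -> exists c : 'I_d -> R, diag_constants T c).
Proof.
move=> T W T' Lambda.
have [[sigma0 _ _] _ _ _ _] := heta.
have irrV : irreducible_mx T' by exact: vertex_irreducible heta hirr he.
have irrT : irreducible_mx T by exact: edge_irreducible he irrV.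
have out i : exists k, initial_vertex (tnth e k) = i by exact: exists_out_edge irrV.
have d0 : (0 < d)%N by have [[k kd] _] := out (Ordinal sigma0); exact: leq_trans kd.
have T0 i j : 0 <= T i j by exact: edge_mx_ge0.
have [_ [u [v uvT]]] := perron_frobenius d0 T0 irrT.
have [u0 v0 _ Tv _] := uvT.
have dLam y : derivable Lambda y 1.
  have irrA : irreducible_mx (T *m W y) by exact: weighted_edge_irreducible.
  have [_ [uy [vy uvy]]] := perron_frobenius d0 (@weighted_edge_ge0 R ca eta _ p0 s0 d e y) irrA.
  by have [] := is_derive_log_spr d0 irrT uvy.
pose a := p0%:R^-1 * \sum_(l < d) v l 0 * u 0 l * (displacement (tnth e l))%:~R.
have dLam0 : is_derive (0 : R) 1 Lambda a.
  have uvT0 : perron_pair (T *m W 0) u v by rewrite weighted_edge0; exact: uvT.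
  exact: is_derive_log_spr d0 irrT uvT0.
have growth D0 : initial_defects D0 -> exists2 s,
    (forall t, uniq (s t)) /\ (forall t x, defects ca eta D0 t x != 0%N -> x \in s t) &
    mgf_growth (defects ca eta D0) s Lambda.
  move=> iD.
  have /choice[s sP] : forall t, exists s : seq int,
      uniq s /\ forall x, defects ca eta D0 t x != 0%N -> x \in s.
    move=> t; have [s us fs] := @defects_supported ca eta D0 t (initial_defects_supported iD).
    by exists s.
  exists s; first by split=> t; have [] := sP t.
  by apply: defects_mgf_growth heta he irrV iD _ _ => t; have [] := sP t.
(* The tangent inequality concerns [Lambda] alone, so one initial configuration is enough to obtain
   it. *)
have iD1 : initial_defects (point_defect 0).
  split; first by exists 0.
  apply: (@sub_finite_set _ _ [set 0]); last exact: finite_set1.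
  by move=> x /=; rewrite /point_defect; have [->|] := eqVneq x 0.
have [s1 _ growth1] := growth _ iD1.
have [La uniqa] := legendre_argmax dLam dLam0 (tangent_below growth1 dLam0).
have Lam0 : Lambda 0 = p0%:R^-1 * ln (spr T) by rewrite /Lambda weighted_edge0.
have maxa : maximizer (legendre Lambda) a.
  move=> b; rewrite La; have := legendre_le Lambda b 0.
  by rewrite oppr0 mul0r add0r.
exists (legendre Lambda); split; [|split; [by move=> alpha; reflexivity|split; [|split; [|split; [|split]]]]].
- move=> D0 iD; have [s [us fs] gs] := growth D0 iD.
  have gE alpha eps : window_growth ca eta D0 alpha eps =
      mass_growth (defects ca eta D0) s alpha eps.
    apply/funext => t; rewrite /window_growth /mass_growth.
    by rewrite (window_defects_mass _ _ (us t) (fs t)).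
  have [up lo] := (fun alpha => (mass_growth_cvg alpha gs dLam).1,
                   fun alpha => (mass_growth_cvg alpha gs dLam).2).
  have gE' alpha : window_growth ca eta D0 alpha = mass_growth (defects ca eta D0) s alpha.
    by apply/funext => eps; exact: gE.
  have upE alpha : lyapunov_profile ca eta D0 alpha = legendre Lambda alpha.
    rewrite /lyapunov_profile gE'; apply: cvg_lim; first exact: ereal_hausdorff.
    exact: up.
  split; last exact: upE.
  move=> alpha; rewrite upE /lower_lyapunov_profile gE'.
  apply: cvg_lim; first exact: ereal_hausdorff.
  exact: lo.
- have vn0 : v != 0.
    by apply/eqP => vE; have := v0 (Ordinal d0); rewrite vE mxE ltxx.
  exact: eigenvalue_col vn0 Tv.
- have sV : spr T' = spr T by exact: (spr_vertex_mx sigma0 out irrT).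
  exists (Lambda 0); split; last by rewrite sV -Lam0; split; reflexivity.
  by split; [exists a; exact: La|move=> b; rewrite -La; exact: maxa].
- exists a; split; first exact: maxa.
  by move=> b bmax; rewrite (uniqa b bmax).
- move=> c cP.
  have -> : \sum_(k < d) c k * (displacement (tnth e k))%:~R =
      \sum_(l < d) v l 0 * u 0 l * (displacement (tnth e l))%:~R.
    by apply: eq_bigr => k _; rewrite (diag_constants_unique d0 T0 irrT uvT cP).
  exact: maxa.
- move=> prim; exists (fun k => v k 0 * u 0 k).
  exact: primitive_diag_constants d0 T0 irrT uvT prim.
Qed.
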